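(* Let $\mathbb{F}$ be a field of characteristic $0$. For every growing parameter $N\in\mathbb{N}$ there is a multilinear polynomial $Q\in\mathbb{F}[x_1,\dots,x_N]$ which is unsatisfiable over $\{0,1\}^N$ such that: (1) there is a multilinear functional refutation $G(\mathbf{x})$ of $Q$ which is computable by a syntactically multilinear circuit of size $\mathrm{poly}(N)$ and depth $O(\log^2 N)$; (2) every multilinear-$\mathsf{NC}^1$-$\mathsf{IPS}_{\mathsf{LIN}'}$ refutation of $Q$ (i.e. an $\mathsf{IPS}_{\mathsf{LIN}'}$ refutation computed by a multilinear formula) has size $N^{\Omega(\log N)}$. *)

(* Defs.v *)
From HB Require Import structures.
From mathcomp Require Import all_boot all_order all_algebra.
From mathcomp Require Import mpoly.
Set Implicit Arguments. Unset Strict Implicit. Unset Printing Implicit Defensive.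
Import Order.TTheory GRing.Theory Num.Theory.
Local Open Scope ring_scope.

Definition multilinear (F : fieldType) (n : nat) (p : {mpoly F[n]}) : Prop :=
  forall m : 'X_{1..n}, m \in msupp p -> forall i : 'I_n, (m i <= 1)%N.

Definition bool_pt (F : fieldType) (n : nat) (v : 'I_n -> bool) : 'I_n -> F :=
  fun i => (v i)%:R.

Definition unsat_cube (F : fieldType) (n : nat) (Q : {mpoly F[n]}) : Prop :=
  forall v : 'I_n -> bool, Q.@[bool_pt F v] != 0.

Inductive aterm (F : Type) (n : nat) : Type :=
| AVar of 'I_n
| AConst of F
| AAdd of aterm F n & aterm F n
| AMul of aterm F n & aterm F n.
Arguments AVar {F n}. Arguments AConst {F n}.
Arguments AAdd {F n}. Arguments AMul {F n}.

Fixpoint aeval (F : fieldType) (n : nat) (t : aterm F n) : {mpoly F[n]} :=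
  match t with
  | AVar i => 'X_i
  | AConst c => c%:MP
  | AAdd a b => aeval a + aeval b
  | AMul a b => aeval a * aeval b
  end.

Fixpoint avars (F : Type) (n : nat) (t : aterm F n) : {set 'I_n} :=
  match t with
  | AVar i => [set i]
  | AConst _ => set0
  | AAdd a b => avars a :|: avars b
  | AMul a b => avars a :|: avars b
  end.

Fixpoint syn_multilinear (F : Type) (n : nat) (t : aterm F n) : Prop :=
  match t with
  | AVar _ | AConst _ => True
  | AAdd a b => syn_multilinear a /\ syn_multilinear b
  | AMul a b => [disjoint avars a & avars b] /\ syn_multilinear a /\ syn_multilinear b
  end.

Fixpoint sem_multilinear (F : fieldType) (n : nat) (t : aterm F n) : Prop :=
  multilinear (aeval t) /\
  match t with
  | AVar _ | AConst _ => True
  | AAdd a b | AMul a b => sem_multilinear a /\ sem_multilinear b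
  end.

Fixpoint adepth (F : Type) (n : nat) (t : aterm F n) : nat :=
  match t with
  | AVar _ | AConst _ => 0
  | AAdd a b | AMul a b => (maxn (adepth a) (adepth b)).+1
  end.

Fixpoint fsize (F : Type) (n : nat) (t : aterm F n) : nat :=
  match t with
  | AVar _ | AConst _ => 1
  | AAdd a b | AMul a b => (fsize a + fsize b).+1
  end.

Fixpoint asubterms (F : Type) (n : nat) (t : aterm F n) : seq (aterm F n) :=
  t :: match t with
       | AVar _ | AConst _ => [::]
       | AAdd a b | AMul a b => asubterms a ++ asubterms b
       end.

(* A circuit is a term read as a DAG with maximal sharing: its size is the
   number of distinct subterms (= number of gates of the DAG). *)
Section ATermEq.
Variables (F : eqType) (n : nat).
Fixpoint aterm_eqb (s t : aterm F n) : bool :=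
  match s, t with
  | AVar i, AVar j => i == j
  | AConst c, AConst d => c == d
  | AAdd a b, AAdd c d => aterm_eqb a c && aterm_eqb b d
  | AMul a b, AMul c d => aterm_eqb a c && aterm_eqb b d
  | _, _ => false
  end.
Lemma aterm_eqP : Equality.axiom aterm_eqb.
Proof.
elim=> [i|c|a IHa b IHb|a IHa b IHb] [j|d|c1 e|c1 e] /=;
  try (by constructor; discriminate).
by apply: (iffP eqP) => [->|[]].
by apply: (iffP eqP) => [->|[]].
apply: (iffP andP) => [[/IHa -> /IHb ->]//|[<- <-]].
  by split; [apply/IHa|apply/IHb].
apply: (iffP andP) => [[/IHa -> /IHb ->]//|[<- <-]].
  by split; [apply/IHa|apply/IHb].
Qed.
HB.instance Definition _ := hasDecEq.Build (aterm F n) aterm_eqP.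
End ATermEq.

Definition csize (F : eqType) (n : nat) (t : aterm F n) : nat :=
  size (undup (asubterms t)).

Definition ml_functional_refutation (F : fieldType) (n : nat)
    (Q G : {mpoly F[n]}) : Prop :=
  multilinear G /\
  (forall v : 'I_n -> bool, G.@[bool_pt F v] * Q.@[bool_pt F v] = 1).

(* substitution x_i |-> x_i (i < n), y |-> Q, where y is the last
   variable (index n) of a polynomial in n+1 variables *)
Definition subst_y (F : fieldType) (n : nat) (Q : {mpoly F[n]}) :
    n.+1.-tuple {mpoly F[n]} :=
  [tuple (if unlift ord_max i is Some j then 'X_j else Q) | i < n.+1].

(* IPS_LIN' refutation of the single axiom Q (with the Boolean axioms
   x_i^2 - x_i): a polynomial C(x,y) = g(x) * y (every monomial has
   y-degree exactly 1, i.e. C is linear in the placeholder y with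
   C(x,0)=0) such that C(x, Q(x)) = 1 modulo the ideal generated by the
   Boolean axioms x_i^2 - x_i.  *)
Definition IPS_LIN'_refutation (F : fieldType) (n : nat)
    (Q : {mpoly F[n]}) (C : {mpoly F[n.+1]}) : Prop :=
  (forall m : 'X_{1..n.+1}, m \in msupp C -> m ord_max = 1%N) /\
  exists h : 'I_n -> {mpoly F[n]},
    comp_mpoly (subst_y Q) C - 1 = \sum_(i < n) h i * ('X_i ^+ 2 - 'X_i).

Definition mlNC1_IPS_LIN'_refutation (F : fieldType) (n : nat)
    (Q : {mpoly F[n]}) (phi : aterm F n.+1) : Prop :=
  sem_multilinear phi /\ IPS_LIN'_refutation Q (aeval phi).

(* Main.v *)
(** A function [G] without zeros on the Boolean cube has the multilinear extension of [1 / G]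
as an axiom it refutes, so only a separation of multilinear circuits and formulas is needed,
in the style of Raz, for some [G = f + c].

The polynomial [f] is defined by recursion on subsets [S] of the variables: [f_S] is a weighted
sum of the products [f_(S :&: I) * f_(S :\: I)] over segments [I], where only sets consisting of
boundedly many segments are kept.  Given a colouring with two colours balanced on [S], sliding a
window around the cycle yields a segment [I] splitting [S] into two balanced halves, or halving
the number of ends of segments of [S].  Alternating the two splittings ends in pairs after
[O(log N)] levels, so suitable weights turn [f] into a product of binomials [x_i - x_j] with [i]
and [j] of different colours, which has a partial derivative matrix of full rank.  Weights in
general position give full rank for all balanced colourings at once.

A multilinear formula of size [s] is a sum of [s] products of logarithmically many functions of
disjoint large blocks of variables.  Under a random colouring each block is unbalanced, and this
makes the mean square of the rank too small. *)
Require Import Defs.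
From mathcomp Require Import all_boot all_order all_algebra.
From mathcomp Require Import mpoly zify ring.
Set Implicit Arguments. Unset Strict Implicit. Unset Printing Implicit Defensive.
Import Order.TTheory GRing.Theory Num.Theory.

(** * Two-colourings and binomial coefficients *)

Lemma leq_bin_half n j : 'C(n, j) <= 'C(n, n./2).
Proof.
have up k : k.*2.+1 <= n -> 'C(n, k) <= 'C(n, k.+1).
  move=> lek; rewrite -(@leq_pmul2l k.+1) // mul_bin_left leq_pmul2r ?bin_gt0; lia.
have low d : forall k, k + d = n./2 -> 'C(n, k) <= 'C(n, n./2).
  elim: d => [|d IHd] k Dk; first by rewrite -Dk addn0.
  by apply: leq_trans (IHd k.+1 _); [apply: up | ]; lia.
have [lej|ltj] := leqP j n./2; first by apply: (low (n./2 - j)); lia.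
have [lejn|ltnj] := leqP j n; last by rewrite bin_small.
by rewrite -bin_sub //; apply: (low (n./2 - (n - j))); lia.
Qed.

Lemma leq_expn2_central n : 2 ^ n <= n.+1 * 'C(n, n./2).
Proof.
rewrite (_ : 2 ^ n = (1 + 1) ^ n) // expnDn -[n.+1 in X in _ <= X]card_ord -sum_nat_const.
by apply: leq_sum => i _; rewrite !exp1n !muln1 leq_bin_half.
Qed.

(** Consecutive central coefficients have ratio 2(2j+1)/(j+1), so the induction step comes down to
    (2j+1)(2j+3) <= 4(j+1)^2. *)
Lemma central_bin_sqr_even j : j.*2.+1 * 'C(j.*2, j) ^ 2 <= 16 ^ j.
Proof.
elim: j => // j IHj.
have E : 'C(j.+1.*2, j.+1) * j.+1 = 2 * j.*2.+1 * 'C(j.*2, j).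
  have h3 := mul_bin_down j.*2.+1 j.
  rewrite doubleS binS.
  have sb : 'C(j.*2.+1, j.+1) = 'C(j.*2.+1, j).
    by rewrite -bin_sub; [congr 'C(_, _)|]; lia.
  rewrite sb addnn -doubleMl mulnC -mul2n; move: h3 => /=.
  by rewrite (_ : j.*2.+1 - j = j.+1) => [<-|]; [rewrite mulnA | lia].
rewrite -(@leq_pmul2r (j.+1 ^ 2)) ?expn_gt0 // -mulnA -expnMn E !expnMn.
rewrite (expnS 16); set C := 'C(_, _) in IHj *; set p := 16 ^ j in IHj *.
have : (j.*2.+1 * C ^ 2) * (j.*2.+3 * (2 ^ 2 * j.*2.+1)) <= p * (16 * j.+1 ^ 2).
  by apply: leq_mul => //; nia.
by congr (_ <= _); [rewrite doubleS; ring | ring].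
Qed.

Lemma central_bin_sqr n : n * 'C(n, n./2) ^ 2 <= 4 ^ n.
Proof.
have Dn := odd_double_half n; case: odd Dn => Dn; move: (n./2) Dn => j <-.
  (* An odd row is reduced to the next even one, whose central coefficient is twice as large. *)
  rewrite add1n; have := central_bin_sqr_even j.+1.
  rewrite doubleS binS.
  have -> : 'C(j.*2.+1, j.+1) = 'C(j.*2.+1, j).
    by rewrite -bin_sub; [congr 'C(_, _)|]; lia.
  rewrite (_ : 16 = 4 ^ 2) // -expnM mul2n doubleS (expnS 4 _.+1).
  set C := 'C(_, _); set p := 4 ^ _; rewrite (_ : (C + C) ^ 2 = 4 * C ^ 2); last by ring.
  by move=> H; rewrite -(@leq_pmul2l 4) //; apply: leq_trans H; nia.
have := central_bin_sqr_even j; rewrite add0n (_ : 16 = 4 ^ 2) // -expnM mul2n; nia.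
Qed.

Lemma sum_expn4 m : 3 * \sum_(i < m) 4 ^ i <= 4 ^ m.
Proof. by rewrite (_ : 3 = 4.-1) // -predn_exp leq_pred. Qed.

(** The exponent rises up to the middle and falls again, so the sum is bounded by two geometric
    sums, each dominated by its last term, which is at most 2^n. *)
Lemma sum_expn4_min n : \sum_(j < n.+1) 4 ^ minn j (n - j) <= 3 * 2 ^ n.
Proof.
have e4 : 4 ^ n./2 <= 2 ^ n.
  by rewrite (_ : 4 = 2 ^ 2) // -expnM leq_exp2l // mul2n -[leqRHS]odd_double_half leq_addl.
have half : \sum_(j < n.+1 | j <= n./2) 4 ^ minn j (n - j) <= \sum_(i < n./2.+1) 4 ^ i.
  rewrite (big_ord_widen_cond n.+1 xpredT (fun i => 4 ^ i)) ?ltnS; last by lia.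
  by apply: leq_sum => i _; rewrite leq_exp2l // geq_minl.
have half' : \sum_(j < n.+1 | ~~ (j <= n./2)) 4 ^ minn j (n - j) <= \sum_(i < n./2.+1) 4 ^ i.
  rewrite (reindex_inj rev_ord_inj) /=.
  rewrite (big_ord_widen_cond n.+1 xpredT (fun i => 4 ^ i)) ?ltnS; last by lia.
  rewrite [leqRHS]big_mkcond [leqLHS]big_mkcond; apply: leq_sum => i _.
  rewrite subSS; case: ifP => // H; rewrite ifT; last by have := ltn_ord i; lia.
  by rewrite leq_exp2l //; have := ltn_ord i; lia.
rewrite (bigID (fun j : 'I_n.+1 => j <= n./2)) /=.
apply: leq_trans (leq_add half half') _; move: (sum_expn4 n./2.+1) e4; rewrite (expnS 4).
by move: (bigop _ _ _) (4 ^ _) (2 ^ _) => a p q; lia.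
Qed.

Lemma sum_powerset_card (T : finType) (A : {set T}) (f : nat -> nat) :
  \sum_(B in powerset A) f #|B| = \sum_(j < #|A|.+1) 'C(#|A|, j) * f j.
Proof.
rewrite (partition_big (fun B : {set T} => inord #|B| : 'I_#|A|.+1) xpredT) //=.
apply: eq_bigr => j _; rewrite -(cards_draws A j) -sum_nat_const.
apply: eq_big => [B|B].
  rewrite powersetE inE; case sBA: (B \subset A) => //=.
  by rewrite -val_eqE /= inordK // ltnS subset_leq_card.
rewrite powersetE => /andP[sBA /eqP <-].
by rewrite inordK // ltnS subset_leq_card.
Qed.

(* The mean of [2 ^ (- |imbalance|)] over a uniform two-colouring of [A] is at most [1 / D]. *)
Lemma sum_powerset_imbalance (T : finType) (A : {set T}) (D : nat) :
  9 * D ^ 2 <= #|A| ->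
  D * \sum_(B in powerset A) 4 ^ minn #|B| (#|A| - #|B|) <= 4 ^ #|A|.
Proof.
move=> leDA; rewrite (sum_powerset_card A (fun j => 4 ^ minn j (#|A| - j))).
set n := #|A| in leDA *.
apply: (@leq_trans (D * ('C(n, n./2) * (3 * 2 ^ n)))).
  rewrite leq_mul2l; apply/orP; right.
  apply: leq_trans (_ : _ <= 'C(n, n./2) * \sum_(j < n.+1) 4 ^ minn j (n - j)) _.
    rewrite big_distrr /=; apply: leq_sum => j _.
    by rewrite leq_mul2r leq_bin_half orbT.
  by rewrite leq_mul2l sum_expn4_min orbT.
(* The constant 9 of the hypothesis comes from squaring this inequality, which reduces it to
   [central_bin_sqr]; the 3 comes from [sum_expn4_min]. *)
have le3 : 3 * D * 'C(n, n./2) <= 2 ^ n.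
  rewrite -leq_sqr; apply: leq_trans (_ : _ <= 4 ^ n) _; last first.
    by rewrite (_ : 4 = 2 ^ 2) // -!expnM mulnC.
  apply: leq_trans (central_bin_sqr n).
  by rewrite expnMn leq_mul2r expnMn leDA orbT.
rewrite (_ : 4 ^ n = 2 ^ n * 2 ^ n); last by rewrite -expnMn.
by have := leq_mul le3 (leqnn (2 ^ n)); move: (2 ^ n) ('C(_, _)) => a b; lia.
Qed.

Lemma sum_powerset_split (T : finType) (A S : {set T}) (f g : {set T} -> nat) :
  A \subset S ->
  \sum_(B in powerset S) f (B :&: A) * g (B :\: A) =
  (\sum_(B in powerset A) f B) * \sum_(B in powerset (S :\: A)) g B.
Proof.
move=> sAS; rewrite big_distrlr /= pair_big /=.
rewrite (reindex_onto (fun p : {set T} * {set T} => p.1 :|: p.2)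
   (fun B => (B :&: A, B :\: A))) /=; last by move=> B _; rewrite setID.
apply: eq_big => [[B C]|[B C]] /=; last first.
  by case/andP=> _ /eqP[-> ->].
rewrite !powersetE; apply/andP/andP => [[sBC /eqP[eB eC]]|[sB sC]].
  by rewrite -{1}eB -{2}eC subsetIr setSD.
have /eqP C0 : C :&: A == set0.
  by rewrite setI_eq0; move: sC; rewrite subsetD => /andP[].
split; first by rewrite subUset (subset_trans sB) // (subset_trans sC) // subsetDl.
rewrite setIUl setDUl C0 setU0 (setIidPl sB) (_ : B :\: A = set0);
  last by apply/eqP; rewrite setD_eq0.
by rewrite set0U; have /setDidPl -> // : [disjoint C & A]; rewrite -setI_eq0 C0.
Qed.

Local Open Scope ring_scope.

(** * Rank across a colouring *)

Section Rank.
Variables (F : fieldType) (T : finType).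
Implicit Types (f g h : {set T} -> F) (A B S U X x y : {set T}).

(** A set [x] stands for the Boolean point whose coordinates equal to 1 are the elements of [x], so
    [x :&: A] resets the coordinates outside [A] to 0. *)
Definition depends_on A f := forall x, f (x :&: A) = f x.

Lemma depends_onS A B f : A \subset B -> depends_on A f -> depends_on B f.
Proof. by move=> sAB fA x; rewrite -fA -setIA (setIidPr sAB) fA. Qed.

Lemma depends_onM A f g :
  depends_on A f -> depends_on A g -> depends_on A (fun x => f x * g x).
Proof. by move=> fA gA x; rewrite fA gA. Qed.

(** This bounds the rank of the matrix of [f] whose rows are indexed by the coordinates in [X] and
    whose columns by the others. As a sum of products it needs no indexing of rows and columns. *)
Definition rank_le X (r : nat) f :=
  exists2 s : seq (({set T} -> F) * ({set T} -> F)), (size s <= r)%N &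
  forall x, f x = \sum_(p <- s) p.1 (x :&: X) * p.2 (x :\: X).

Lemma rank_leW X r r' f : (r <= r')%N -> rank_le X r f -> rank_le X r' f.
Proof. by move=> ler [s /leq_trans sz fE]; exists s; first exact: sz. Qed.

Lemma rank_le_ext X r f g : f =1 g -> rank_le X r f -> rank_le X r g.
Proof. by move=> fg [s sz fE]; exists s => // x; rewrite -fg. Qed.

Lemma rank_leD X r1 r2 f g :
  rank_le X r1 f -> rank_le X r2 g -> rank_le X (r1 + r2) (fun x => f x + g x).
Proof.
move=> [s sz fE] [s' sz' gE]; exists (s ++ s'); first by rewrite size_cat leq_add.
by move=> x; rewrite fE gE big_cat.
Qed.

Lemma rank_le_sum X (n : nat) (r : nat -> nat) (f : nat -> {set T} -> F) :
  (forall i, (i < n)%N -> rank_le X (r i) (f i)) ->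
  rank_le X (\sum_(i < n) r i) (fun x => \sum_(i < n) f i x).
Proof.
elim: n => [|n IHn] fr; first by exists [::] => // x; rewrite big_nil big_ord0.
rewrite big_ord_recr /=; apply: rank_le_ext (_ : rank_le X _ (fun x => \sum_(i < n) f i x + f n x)).
  by move=> x; rewrite big_ord_recr.
apply: rank_leD; last exact: fr.
by apply: IHn => i ltin; apply: fr; apply: leqW.
Qed.

Lemma rank_leM X r1 r2 f g :
  rank_le X r1 f -> rank_le X r2 g -> rank_le X (r1 * r2) (fun x => f x * g x).
Proof.
move=> [s sz fE] [s' sz' gE].
exists [seq (fun x => p.1 x * q.1 x, fun x => p.2 x * q.2 x) | p <- s, q <- s'].
  by rewrite size_allpairs leq_mul.
move=> x; rewrite big_allpairs_dep fE gE big_distrlr /=.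
by apply: eq_bigr => p _; apply: eq_bigr => q _; rewrite mulrACA.
Qed.

Lemma rank_leC X r f : rank_le X r f -> rank_le (~: X) r f.
Proof.
move=> [s sz fE]; exists [seq (p.2, p.1) | p <- s]; first by rewrite size_map.
by move=> x; rewrite fE big_map; apply: eq_bigr => p _; rewrite !setDE setCK mulrC.
Qed.

(** There is one summand for each trace [B] of the point on [A :&: X]: the indicator of that trace,
    times [f] with the trace fixed. *)
Lemma rank_le_inside X A f : depends_on A f -> rank_le X (2 ^ #|A :&: X|) f.
Proof.
move=> fA; pose s := enum (powerset (A :&: X)).
exists [seq (fun y => (y :&: A == B)%:R, fun z => f (B :|: z)) | B <- s].
  by rewrite size_map -cardE card_powerset.
move=> x; rewrite big_map /= (bigD1_seq (x :&: X :&: A)) ?enum_uniq //=; last first.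
  by rewrite mem_enum powersetE [_ :&: A]setIC setIS ?subsetIr.
rewrite eqxx mul1r big1 ?addr0 => [|B neqB]; last first.
  by rewrite eq_sym (negPf neqB) mul0r.
rewrite -fA -[RHS]fA; congr f; apply/setP=> i; rewrite !inE.
by case: (i \in x); case: (i \in X); case: (i \in A).
Qed.

Lemma rank_le_depends X A f :
  depends_on A f -> rank_le X (2 ^ minn #|A :&: X| #|A :\: X|) f.
Proof.
move=> fA; have [_|_] := leqP #|A :&: X| #|A :\: X|; first exact: rank_le_inside.
by rewrite setDE -{1}[X]setCK; apply: rank_leC; apply: rank_le_inside.
Qed.

(** The [k] factors [h] live on disjoint blocks of at least [M] variables; the last factor, on what
    remains of [S], has no size condition. *)
Fixpoint block_product (M k : nat) S f : Prop :=
  if k is k'.+1 then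
    exists A h g, [/\ A \subset S, (M <= #|S :\: A|)%N, depends_on (S :\: A) h,
      block_product M k' A g & forall x, f x = h x * g x]
  else depends_on S f.

(** Disjoint blocks are coloured independently, so the sum of squared rank bounds factors over the
    blocks. By [sum_powerset_imbalance] each of the [k] blocks saves a factor [D]. Letting [q] see
    only [X :&: S] is what makes the sum factor. *)
Lemma block_product_rank D k S f :
  block_product (9 * D ^ 2) k S f ->
  exists2 q : {set T} -> nat, (forall X, rank_le X (q (X :&: S)) f) &
  (D ^ k * \sum_(X in powerset S) q X ^ 2 <= 4 ^ #|S|)%N.
Proof.
elim: k => [|k IHk] in S f *.
  move=> fS; exists (fun B => (2 ^ minn #|B| (#|S| - #|B|)))%N.
    move=> X; apply: rank_leW (rank_le_depends X fS).
    by rewrite leq_exp2l // setIC cardsD setIC.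
  rewrite expn0 mul1n (_ : 4 = 2 * 2)%N // expnMn -{1}card_powerset -sum_nat_const.
  apply: leq_sum => B _; rewrite -expnM leq_exp2l // minnE; lia.
case=> A [h [g [sAS leM hS /IHk[q qr qsum] fE]]].
pose m B := (2 ^ minn #|B| (#|S :\: A| - #|B|))%N.
exists (fun B => (q (B :&: A) * m (B :\: A)))%N => [X|].
  apply: rank_le_ext (_ : rank_le X _ (fun x => g x * h x)).
    by move=> x; rewrite fE mulrC.
  apply: rank_leM; first by rewrite -setIA (setIidPr sAS).
  apply: rank_leW (rank_le_depends X hS).
  by rewrite leq_exp2l // -setIDA setIC cardsD setIC.
under eq_bigr do rewrite expnMn.
rewrite (sum_powerset_split (fun B => q B ^ 2) (fun B => m B ^ 2))%N //.
have -> : #|S| = (#|A| + #|S :\: A|)%N by rewrite -(cardsID A S) (setIidPr sAS).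
rewrite expnD expnS (mulnC D) mulnACA leq_mul //.
apply: leq_trans (sum_powerset_imbalance leM); rewrite leq_mul2l; apply/orP; right.
by apply: leq_sum => B _; rewrite /m -expnM mulnC expnM.
Qed.

Definition block_sum (M k : nat) S (s : nat) f :=
  exists m (g : nat -> {set T} -> F), [/\ (m <= s)%N,
    forall i, (i < m)%N -> block_product M k S (g i) &
    forall x, f x = \sum_(i < m) g i x].

Lemma block_sum_ext M k S s f g : f =1 g -> block_sum M k S s f -> block_sum M k S s g.
Proof. by move=> fg [m [u [? ? fE]]]; exists m, u; split=> // x; rewrite -fg. Qed.

Lemma block_sumW M k S s s' f : (s <= s')%N -> block_sum M k S s f -> block_sum M k S s' f.
Proof. by move=> les [m [u [/leq_trans-/(_ _ les) ? ? ?]]]; exists m, u. Qed.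

Lemma block_sum1 M k S f : block_product M k S f -> block_sum M k S 1 f.
Proof. by move=> fS; exists 1%N, (fun=> f); split=> // x; rewrite big_ord1. Qed.

Lemma block_sumD M k S s1 s2 f g :
  block_sum M k S s1 f -> block_sum M k S s2 g ->
  block_sum M k S (s1 + s2) (fun x => f x + g x).
Proof.
move=> [m [u [lem uP fE]]] [m' [u' [lem' uP' gE]]].
exists (m + m')%N, (fun i => if (i < m)%N then u i else u' (i - m)%N); split.
- exact: leq_add.
- move=> i lti; case: ltnP => [/uP //|lemi]; apply: uP'; lia.
move=> x; rewrite big_split_ord fE gE /=; congr (_ + _); apply: eq_bigr => i _.
  by rewrite ltn_ord.
by rewrite ltnNge leq_addr addKn.
Qed.

Lemma block_sum_step M k A S s f h :
  A \subset S -> (M <= #|S :\: A|)%N -> depends_on (S :\: A) h ->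
  block_sum M k A s f -> block_sum M k.+1 S s (fun x => f x * h x).
Proof.
move=> sAS leM hS [m [u [lem uP fE]]]; exists m, (fun i x => h x * u i x); split=> //.
  by move=> i ltim; exists A, h, (u i); split=> //; exact: uP.
by move=> x; rewrite fE mulrC big_distrr.
Qed.

(** Rank is subadditive, and by the Cauchy-Schwarz inequality the squared sum of [m] rank bounds is
    at most [m] times the sum of their squares, whence the factor [s ^ 2]. *)
Lemma block_sum_rank_bound D k S s f :
  block_sum (9 * D ^ 2) k S s f ->
  exists2 r : {set T} -> nat, (forall X, X \subset S -> rank_le X (r X) f) &
  (D ^ k * \sum_(X in powerset S) r X ^ 2 <= s ^ 2 * 4 ^ #|S|)%N.
Proof.
case=> m [u [lem uP fE]].
have /(fin_all_exists2 (P := fun (i : 'I_m) q => forall X, rank_le X (q (X :&: S)) (u i))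
   (Q := fun i q => (D ^ k * \sum_(X in powerset S) q X ^ 2 <= 4 ^ #|S|)%N))[q qr qs] :
   forall i : 'I_m, exists2 q : {set T} -> nat, (forall X, rank_le X (q (X :&: S)) (u i)) &
   (D ^ k * \sum_(X in powerset S) q X ^ 2 <= 4 ^ #|S|)%N.
  by move=> i; apply: block_product_rank; apply: uP.
(* The bounds are extended by 0 to all natural indices, the form taken by [rank_le_sum]. *)
pose q' X i := if insub i is Some j then q j X else 0%N.
exists (fun X => \sum_(i < m) q i X)%N => [X sXS|].
  apply: rank_le_ext (_ : rank_le X _ (fun x => \sum_(i < m) u i x)); first by move=> x; rewrite fE.
  rewrite (_ : (\sum_(i < m) _ = \sum_(i < m) q' X i)%N); last first.
    by apply: eq_bigr => i _; rewrite /q' valK.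
  apply: (rank_le_sum (r := q' X)) => i ltim; rewrite /q' insubT.
  by have := qr (Ordinal ltim) X; rewrite (setIidPl sXS).
have CS (a : 'I_m -> nat) : ((\sum_i a i) ^ 2 <= m * \sum_i a i ^ 2)%N.
  rewrite -mulnn big_distrlr /=.
  apply: (@leq_trans (\sum_i \sum_j (a i ^ 2 + a j ^ 2) %/ 2))%N.
    apply: leq_sum => i _; apply: leq_sum => j _; rewrite leq_divRL // mulnC.
    exact: (nat_Cauchy (a i) (a j)).1.
  apply: (@leq_trans ((\sum_i \sum_j (a i ^ 2 + a j ^ 2)) %/ 2))%N.
    rewrite leq_divRL // big_distrl /=; apply: leq_sum => i _.
    by rewrite big_distrl /=; apply: leq_sum => j _; exact: leq_trunc_div.
  under eq_bigr do rewrite big_split sum_nat_const card_ord /=.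
  rewrite big_split /= sum_nat_const card_ord -big_distrr /=.
  by rewrite addnn -muln2 mulnK.
apply: (@leq_trans (D ^ k * \sum_(X in powerset S) (m * \sum_i q i X ^ 2)))%N.
  by rewrite leq_mul2l; apply/orP; right; apply: leq_sum => X _; exact: CS.
rewrite -big_distrr /= exchange_big /= mulnCA.
apply: (@leq_trans (m * (m * 4 ^ #|S|)))%N; last by rewrite mulnA leq_mul // mulnn leq_sqr.
rewrite leq_mul2l; apply/orP; right; rewrite big_distrr /=.
by rewrite -[m in (m * _)%N]card_ord -sum_nat_const; apply: leq_sum => i _; exact: qs.
Qed.

End Rank.

(** * Formulas as sums of products over blocks *)

Lemma set_between (T : finType) (A B : {set T}) k :
  A \subset B -> (#|A| <= k <= #|B|)%N ->
  exists C : {set T}, [/\ A \subset C, C \subset B & #|C| = k].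
Proof.
move=> sAB; elim: k => [|k IHk] /andP[leA leB].
  by exists A; split=> //; apply/eqP; rewrite -leqn0.
have [eqA|neqA] := eqVneq #|A| k.+1; first by exists A; split.
have [|C [sAC sCB cC]] := IHk; first by lia.
have /set0Pn[i] : B :\: C != set0.
  by rewrite -card_gt0 cardsD (setIidPr sCB) cC; lia.
rewrite inE => /andP[iC iB]; exists (i |: C); split.
- exact: subset_trans sAC (subsetUr _ _).
- by rewrite subUset sub1set iB.
- by rewrite cardsU1 iC cC.
Qed.

Section FormulaBlocks.
Variables (F : fieldType) (n : nat) (T : finType) (e : 'I_n -> option T).
Hypothesis e_inj : forall i j a, e i = Some a -> e j = Some a -> i = j.

(* In the application [e] forgets the placeholder variable, whose value is [1]. *)
Definition cube_val (t : aterm F n) (x : {set T}) : F :=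
  (aeval t).@[fun i => if e i is Some a then (a \in x)%:R else 1].

Definition live_vars (t : aterm F n) : {set T} :=
  [set a | [exists i in avars t, e i == Some a]].

Lemma cube_valD a b x : cube_val (AAdd a b) x = cube_val a x + cube_val b x.
Proof. exact: mevalD. Qed.

Lemma cube_valM a b x : cube_val (AMul a b) x = cube_val a x * cube_val b x.
Proof. exact: mevalM. Qed.

Lemma live_varsU (a b t : aterm F n) : avars t = avars a :|: avars b ->
  live_vars t = live_vars a :|: live_vars b.
Proof.
move=> tE; apply/setP=> i; rewrite !inE; apply/existsP/orP => [[j]|].
  rewrite tE inE => /andP[/orP[ja|jb] je]; [left|right]; apply/existsP; exists j.
    by rewrite ja.
  by rewrite jb.
by case=> /existsP[j /andP[ja je]]; exists j; rewrite tE inE ja ?orbT.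
Qed.

Lemma disjoint_live_vars a b :
  [disjoint avars a & avars b] -> [disjoint live_vars a & live_vars b].
Proof.
move=> /pred0P dab; apply/pred0P=> i; rewrite /= !inE; apply/negP.
case/andP=> /existsP[j /andP[ja /eqP ej]] /existsP[k /andP[kb /eqP ek]].
by have /negP := dab j; rewrite /= ja (e_inj ej ek) kb.
Qed.

Lemma cube_val_depends t : depends_on (live_vars t) (cube_val t).
Proof.
elim: t => [i|c|a IHa b IHb|a IHa b IHb] x.
- rewrite /cube_val /= !mevalXU; case ei: (e i) => [j|] //; rewrite inE.
  case: (_ \in x) => //=; rewrite inE; case: existsP => // [[]].
  by exists i; rewrite inE eqxx ei eqxx.
- by rewrite /cube_val /= !mevalC.
- have tE := @live_varsU a b (AAdd a b) erefl.
  by rewrite !cube_valD tE (depends_onS (subsetUl _ _) IHa) (depends_onS (subsetUr _ _) IHb).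
- have tE := @live_varsU a b (AMul a b) erefl.
  by rewrite !cube_valM tE (depends_onS (subsetUl _ _) IHa) (depends_onS (subsetUr _ _) IHb).
Qed.

Lemma card_live_leaf t : (fsize t <= 1)%N -> (#|live_vars t| <= 1)%N.
Proof.
case: t => [i|c|a b|a b] /=; rewrite ?ltnS ?leqn0 ?addn_eq0.
- move=> _; apply/card_le1P=> a; rewrite inE => /existsP[j /andP[/set1P -> /eqP ea]] b.
  rewrite !inE; apply/existsP/eqP => [[k /andP[/set1P -> /eqP eb]]|->].
    by move: eb; rewrite ea => -[].
  by exists i; rewrite inE eqxx ea eqxx.
- move=> _; rewrite (_ : live_vars _ = set0) ?cards0 //; apply/setP=> i; rewrite !inE.
  by apply/existsP=> -[j]; rewrite inE.
- by case: a.
- by case: a.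
Qed.

(* [h] collects the small factors met on the way down to a subformula with between a third
   and two thirds of the variables of [S]; descending to the larger factor of each product,
   [h] depends on at most a third of [S]. *)
Lemma formula_block_sum (M k : nat) (t : aterm F n) (S U : {set T})
    (h : {set T} -> F) :
  (0 < M)%N -> syn_multilinear t -> live_vars t \subset S -> U \subset S ->
  [disjoint U & live_vars t] -> (3 * #|U| <= #|S|)%N -> (M * 3 ^ k <= #|S|)%N ->
  depends_on U h ->
  block_sum M k S (fsize t) (fun x => cube_val t x * h x).
Proof.
move=> M0; elim: k => [|k IHk] in t S U h *.
  move=> _ tS US _ _ _ hU; apply: block_sumW (block_sum1 _).
    by case: (t).
  by apply: depends_onM; [apply: (depends_onS tS (@cube_val_depends t)) |
    apply: (depends_onS _ hU)].
(* When [A] has between one and two thirds of [S'], the collected factor becomes a block on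
   [S' :\: A] with at least [M] variables, and [A] is large enough for [k] further blocks, found
   afresh with the collected factor 1. *)
have base t' (A S' : {set T}) h' : (M * 3 ^ k.+1 <= #|S'|)%N -> syn_multilinear t' ->
    live_vars t' \subset A -> A \subset S' ->
    (#|S'| <= 3 * #|A|)%N -> (3 * #|A| <= 2 * #|S'|)%N -> depends_on (S' :\: A) h' ->
    block_sum M k.+1 S' (fsize t') (fun x => cube_val t' x * h' x).
  move=> leM syn' tA AS' leA leA' hA; apply: (@block_sum_step _ _ M k A) => //.
    move: leM; rewrite expnS cardsD (setIidPr AS').
    have : (M <= M * 3 ^ k)%N by rewrite leq_pmulr // expn_gt0.
    lia.
  apply: (block_sum_ext (f := fun x => cube_val t' x * 1)).
    by move=> x; rewrite mulr1.
  apply: (IHk t' A set0 (fun=> 1)) => //; rewrite ?sub0set ?cards0 //.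
    by rewrite -setI_eq0 set0I.
  by move: leM; rewrite expnS; lia.
(* With at most two thirds of the variables live, they are padded to a set [A] of about two thirds
   of [S']. The padding avoids [U'], which leaves room since [U'] has at most a third of [S']. *)
have small t' (S' U' : {set T}) h' : (M * 3 ^ k.+1 <= #|S'|)%N -> syn_multilinear t' ->
    live_vars t' \subset S' -> U' \subset S' -> [disjoint U' & live_vars t'] ->
    (3 * #|U'| <= #|S'|)%N -> depends_on U' h' -> (3 * #|live_vars t'| <= 2 * #|S'|)%N ->
    block_sum M k.+1 S' (fsize t') (fun x => cube_val t' x * h' x).
  move=> leM syn' tS US dUt leU hU let'.
  have S3 : (3 <= #|S'|)%N.
    have : (0 < M * 3 ^ k)%N by rewrite muln_gt0 M0 expn_gt0.
    by move: leM; rewrite expnS; lia.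
  have sub : live_vars t' \subset S' :\: U' by rewrite subsetD tS disjoint_sym.
  have cSU : #|S' :\: U'| = (#|S'| - #|U'|)%N by rewrite cardsD (setIidPr US).
  have [|A [tA AS cA]] := set_between (k := maxn #|live_vars t'| (2 * #|S'| %/ 3)) sub.
    by have := subset_leq_card sub; rewrite cSU; lia.
  apply: (base t' A) => //; rewrite ?cA.
  - exact: subset_trans AS (subsetDl _ _).
  - by have := leq_maxr #|live_vars t'| (2 * #|S'| %/ 3); lia.
  - by rewrite /maxn; case: ifP; lia.
  apply: (depends_onS _ hU); apply/subsetP => i iU; rewrite inE (subsetP US) // andbT.
  by apply/negP => /(subsetP AS); rewrite inE iU.
elim: t => [i|c|a IHa b IHb|a IHa b IHb] in U h * => syn tS US dUt leU leM hU.
- apply: (small _ _ U) => //; have := @card_live_leaf (AVar i) isT.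
  have : (0 < M * 3 ^ k)%N by rewrite muln_gt0 M0 expn_gt0.
  move: leM; rewrite expnS; lia.
- apply: (small _ _ U) => //; have := @card_live_leaf (AConst c) isT.
  have : (0 < M * 3 ^ k)%N by rewrite muln_gt0 M0 expn_gt0.
  move: leM; rewrite expnS; lia.
- move: tS dUt; rewrite (@live_varsU a b) // subUset => /andP[aS bS].
  rewrite -setI_eq0 setIUr setU_eq0 !setI_eq0 => /andP[dUa dUb].
  case: syn => syna synb; apply: block_sumW (leqnSn _) _.
  apply: block_sum_ext (block_sumD (IHa U h _ _ _ _ _ _ _) (IHb U h _ _ _ _ _ _ _)) => // x.
  by rewrite cube_valD mulrDl.
have [small_t|big_t] := leqP (3 * #|live_vars (AMul a b)|) (2 * #|S|).
  exact: (small _ _ U).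
move: tS dUt; rewrite (@live_varsU a b) // subUset => /andP[aS bS].
rewrite -setI_eq0 setIUr setU_eq0 !setI_eq0 => /andP[dUa dUb].
case: syn => dab [syna synb].
(* The larger factor [a'] has more than a third of [S], as the product has more than two thirds. If
   [a'] has at most two thirds, [base] applies; otherwise less than a third lies outside it and the
   descent continues. *)
have main (a' b' : aterm F n) : syn_multilinear a' ->
    (forall (U : {set T}) h, syn_multilinear a' -> live_vars a' \subset S -> U \subset S ->
      [disjoint U & live_vars a'] -> (3 * #|U| <= #|S|)%N -> (M * 3 ^ k.+1 <= #|S|)%N ->
      depends_on U h -> block_sum M k.+1 S (fsize a') (fun x => cube_val a' x * h x)) ->
    (#|live_vars b'| <= #|live_vars a'|)%N -> [disjoint live_vars a' & live_vars b'] ->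
    live_vars (AMul a b) = live_vars a' :|: live_vars b' ->
    live_vars a' \subset S -> live_vars b' \subset S -> [disjoint U & live_vars a'] ->
    block_sum M k.+1 S (fsize a') (fun x => cube_val a' x * (cube_val b' x * h x)).
  move=> syna' IH leba dab' tE aS' bS' dUa'.
  have hb : depends_on (S :\: live_vars a') (fun x => cube_val b' x * h x).
    apply: depends_onM.
      by apply: (depends_onS _ (@cube_val_depends b')); rewrite subsetD bS' disjoint_sym.
    by apply: (depends_onS _ hU); rewrite subsetD US.
  have cab : #|live_vars (AMul a b)| = (#|live_vars a'| + #|live_vars b'|)%N.
    by rewrite tE cardsU; move: dab'; rewrite -setI_eq0 => /eqP ->; rewrite cards0 subn0.
  have [le2a|gt2a] := leqP (3 * #|live_vars a'|) (2 * #|S|).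
    by apply: (base a' (live_vars a')) => //; move: leba big_t; rewrite cab; clear; lia.
  apply: (IH (S :\: live_vars a')) => //; first exact: subsetDl.
    by rewrite -setI_eq0 setIDAC setDIl setDv setI0.
  by rewrite cardsD (setIidPr aS'); move: gt2a; clear; lia.
have [leab|ltba] := leqP #|live_vars b| #|live_vars a|.
  apply: block_sumW (_ : fsize a <= _)%N _; first by rewrite /=; lia.
  apply: block_sum_ext (main a b syna IHa leab _ _ aS bS dUa).
  - by move=> x; rewrite cube_valM mulrA.
  - exact: disjoint_live_vars.
  exact: live_varsU.
apply: block_sumW (_ : fsize b <= _)%N _; first by rewrite /=; lia.
apply: block_sum_ext (main b a synb IHb (ltnW ltba) _ _ bS aS dUb).
- by move=> x; rewrite cube_valM mulrCA mulrA.
- by rewrite disjoint_sym; apply: disjoint_live_vars.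
by rewrite setUC; apply: live_varsU.
Qed.

End FormulaBlocks.

(** * Multilinear polynomials *)

Section VariableDegree.
Variables (F : fieldType) (n : nat).
Implicit Types (p q : {mpoly F[n]}) (i : 'I_n).

Definition occurs i p := has (fun m : 'X_{1..n} => m i != 0)%N (msupp p).

(* [p] as a polynomial in the [i]-th variable, which makes the degree in that variable
   the degree of an ordinary polynomial over a domain. *)
Definition mark_var i (j : 'I_n) : {poly {mpoly F[n]}} :=
  ('X_j)%:P * 'X ^+ (j == i).

Definition graded_at i : {mpoly F[n]} -> {poly {mpoly F[n]}} :=
  mmap (polyC \o @mpolyC n F) (mark_var i).

Lemma graded_atE i p :
  graded_at i p = \sum_(m <- msupp p) (p@_m *: 'X_[m])%:P * 'X ^+ m i.
Proof.
rewrite /graded_at /mmap; apply: eq_bigr => m _; rewrite /mmap1.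
under eq_bigr do rewrite /mark_var exprMn.
rewrite big_split /= [X in _ * (_ * X)](bigD1 i) //= eqxx expr1.
rewrite [X in _ * (_ * (_ * X))]big1 ?mulr1 => [|j /negPf->]; last by rewrite expr0 expr1n.
rewrite mulrA; congr (_ * _); rewrite -mul_mpolyC (mpolyXE_id F m) rmorphM /= rmorph_prod.
by congr (_ * _); apply: eq_bigr => j _; rewrite rmorphXn.
Qed.

Lemma graded_at_coef i p k m : (graded_at i p)`_k@_m = (m i == k)%:R * p@_m.
Proof.
rewrite graded_atE coef_sum raddf_sum /=.
have [mp|] := boolP (m \in msupp p); last first.
  move=> mNp; rewrite [p@_m]memN_msupp_eq0 // mulr0 big1_seq // => m' /andP[_ m'p].
  rewrite coefCM coefXn; case: eqP => _; rewrite ?mulr0 ?mcoeff0 // mulr1 mcoeffZ mcoeffX.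
  by case: eqP m'p mNp => [->->|]; rewrite ?mulr0.
rewrite (bigD1_seq m) ?msupp_uniq //= big1 ?addr0 => [|m' /negPf neq].
  rewrite coefCM coefXn eq_sym; case: eqP => _; rewrite ?(mulr0, mul0r) ?mcoeff0 //.
  by rewrite mulr1 mcoeffZ mcoeffX eqxx mulr1 mul1r.
rewrite coefCM coefXn; case: eqP => _; rewrite ?mulr0 ?mcoeff0 //.
by rewrite mulr1 mcoeffZ mcoeffX neq mulr0.
Qed.

Lemma size_graded_at_gt i p k :
  (exists2 m : 'X_{1..n}, m \in msupp p & (k <= m i)%N) <-> (k < size (graded_at i p))%N.
Proof.
split=> [[m mp km]|ltk].
  apply: leq_ltn_trans km _; rewrite ltnNge; apply/negP => le_i.
  have := graded_at_coef i p (m i) m; rewrite nth_default // mcoeff0 eqxx mul1r.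
  by move/esym/eqP; rewrite mcoeff_eq0 mp.
have : lead_coef (graded_at i p) != 0 by rewrite lead_coef_eq0 -size_poly_gt0; case: size ltk.
rewrite /lead_coef -msupp_eq0; case Dm: (msupp _) => [|m ms] // _.
have : m \in msupp (graded_at i p)`_(size (graded_at i p)).-1 by rewrite Dm mem_head.
rewrite mcoeff_msupp graded_at_coef; case: (m i =P _) => [mi|_]; last by rewrite mul0r eqxx.
by rewrite mul1r -mcoeff_msupp => mp; exists m => //; rewrite mi -ltnS prednK //; case: size ltk.
Qed.

Lemma graded_atM i : {morph graded_at i : p q / p * q}.
Proof. by have [+ _] := mmap_is_multiplicative (mark_var i) (polyC \o @mpolyC n F). Qed.

Lemma size_graded_atM i p q :
  (0 < size (graded_at i p))%N -> (0 < size (graded_at i q))%N ->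
  size (graded_at i (p * q)) = (size (graded_at i p) + size (graded_at i q)).-1.
Proof.
rewrite graded_atM; move: (graded_at i p) (graded_at i q) => P Q.
by rewrite !size_poly_gt0 => nzP nzQ; rewrite size_mul.
Qed.

Opaque graded_at.

(** Over a domain the degrees in the variable [i] add up, so a variable occurring in both factors
    would have degree at least 2 in the product. *)
Lemma multilinear_mul_occurs i p q :
  multilinear (p * q) -> p * q != 0 -> occurs i p -> ~~ occurs i q.
Proof.
move=> ml nz /hasP[m mp mi]; apply/negP => /hasP[m' m'q m'i].
have sp : (1 < size (graded_at i p))%N by apply/size_graded_at_gt; exists m; rewrite ?lt0n.
have sq : (1 < size (graded_at i q))%N by apply/size_graded_at_gt; exists m'; rewrite ?lt0n.
have : (2 < size (graded_at i (p * q)))%N.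
  rewrite (size_graded_atM (ltnW sp) (ltnW sq)).
  by move: sp sq; generalize (size (graded_at i p)) (size (graded_at i q)) => a b; lia.
by case/size_graded_at_gt => m'' /ml /(_ i) le1 /leq_trans/(_ le1).
Qed.

Lemma meval_occurs p (v w : 'I_n -> F) :
  (forall i, occurs i p -> v i = w i) -> p.@[v] = p.@[w].
Proof.
move=> vw; rewrite !mevalE; apply: eq_big_seq => m mp; congr (_ * _).
apply: eq_bigr => i _; have [->|mi] := eqVneq (m i) 0%N; first by rewrite !expr0.
by rewrite vw //; apply/hasP; exists m.
Qed.

(** This serves to erase from a formula the variables that cancel in its polynomial. *)
Fixpoint zero_outside (A : pred 'I_n) (t : aterm F n) : aterm F n :=
  match t with
  | AVar i => if A i then AVar i else AConst 0
  | AConst c => AConst c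
  | AAdd a b => AAdd (zero_outside A a) (zero_outside A b)
  | AMul a b => AMul (zero_outside A a) (zero_outside A b)
  end.

Lemma zero_outside_eval A t v :
  (aeval (zero_outside A t)).@[v] = (aeval t).@[fun i => if A i then v i else 0].
Proof.
elim: t => [i|c|a IHa b IHb|a IHa b IHb] /=.
- by case: ifP => Ai; rewrite !(mevalXU, mevalC) Ai.
- by rewrite !mevalC.
- by rewrite !mevalD IHa IHb.
- by rewrite !mevalM IHa IHb.
Qed.

Lemma zero_outside_vars A t :
  avars (zero_outside A t) \subset avars t :&: [set i | A i].
Proof.
elim: t => [i|c|a IHa b IHb|a IHa b IHb] /=; rewrite ?sub0set //.
- by case: ifP => Ai; rewrite ?sub0set //= subsetI subxx sub1set inE.
- by rewrite setIUl setUSS.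
- by rewrite setIUl setUSS.
Qed.

Lemma zero_outside_syn A t : syn_multilinear t -> syn_multilinear (zero_outside A t).
Proof.
elim: t => [i|c|a IHa b IHb|a IHa b IHb] //=; first by case: ifP.
  by case=> /IHa ? /IHb.
case=> dab [/IHa ? /IHb ?]; split=> //.
have sub t := subset_trans (zero_outside_vars A t) (subsetIl _ _).
exact: disjointWl (sub a) (disjointWr (sub b) dab).
Qed.

Lemma zero_outside_size A t : fsize (zero_outside A t) = fsize t.
Proof. by elim: t => [i|c|a IHa b IHb|a IHa b IHb] //=; [case: ifP | rewrite IHa IHb..]. Qed.

(** The induction keeps only variables that occur in the computed polynomial. At a sum, the
    cancelled variables are set to 0; at a nonzero product, [multilinear_mul_occurs] makes the two
    sets of variables disjoint; a zero product becomes a constant. *)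
Lemma sem_to_syn_multilinear (t : aterm F n) : sem_multilinear t ->
  exists t', [/\ forall v, (aeval t').@[v] = (aeval t).@[v], syn_multilinear t',
    (fsize t' <= fsize t)%N & forall i, i \in avars t' -> occurs i (aeval t)].
Proof.
elim: t => [i|c|a IHa b IHb|a IHa b IHb].
- move=> _; exists (AVar i); split=> // j /set1P ->.
  by rewrite /occurs /= msuppX /= mnm1E eqxx.
- by move=> _; exists (AConst c); split=> // i; rewrite inE.
- case=> _ [/IHa[a' [ea syna leA va]] /IHb[b' [eb synb leB vb]]].
  pose A := [pred i | occurs i (aeval (AAdd a b))].
  exists (zero_outside A (AAdd a' b')); split.
  + move=> v; rewrite zero_outside_eval /= mevalD ea eb -mevalD.
    by apply: meval_occurs => i Ai; rewrite /A /= Ai.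
  + exact: zero_outside_syn.
  + by rewrite zero_outside_size /= ltnS leq_add.
  + by move=> i /(subsetP (zero_outside_vars _ _)); rewrite !inE => /andP[].
case=> ml [/IHa[a' [ea syna leA va]] /IHb[b' [eb synb leB vb]]].
have [z|nz] := eqVneq (aeval a * aeval b) 0.
  by exists (AConst 0); split=> // [v|i]; rewrite /= ?z ?inE.
exists (AMul a' b'); split=> /=.
- by move=> v; rewrite !mevalM ea eb.
- split=> //; apply/pred0P => i /=; apply/negP => /andP[/va ia /vb ib].
  by have := multilinear_mul_occurs ml nz ia; rewrite ib.
- by rewrite ltnS leq_add.
have nza : aeval a != 0 by apply: contraNneq nz => ->; rewrite mul0r.
have nzb : aeval b != 0 by apply: contraNneq nz => ->; rewrite mulr0.
have occ i : occurs i (aeval a) || occurs i (aeval b) -> occurs i (aeval a * aeval b).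
  have E p : occurs i p = (1 < size (graded_at i p))%N.
    apply/hasP/idP => [[m mp mi]|/size_graded_at_gt[m mp mi]].
      by apply/size_graded_at_gt; exists m; rewrite ?lt0n.
    by exists m; rewrite // -lt0n.
  have S0 p : p != 0 -> (0 < size (graded_at i p))%N.
    rewrite -msupp_eq0; case Dm: (msupp p) => [|m ms] // _.
    by apply/size_graded_at_gt; exists m; rewrite ?Dm ?mem_head.
  rewrite (E (aeval a)) (E (aeval b)) (E (aeval a * aeval b)) => occ_ab.
  have sa := S0 _ nza; have sb := S0 _ nzb; rewrite (size_graded_atM sa sb).
  move: sa sb occ_ab.
  by generalize (size (graded_at i (aeval a))) (size (graded_at i (aeval b))) => k l; lia.
by move=> i; rewrite inE => /orP[/va|/vb] ii; apply: occ; rewrite ii ?orbT.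
Qed.

End VariableDegree.

(** * Multilinear extension of functions on the Boolean cube *)

Section Multilinear.
Variables (F : fieldType) (n : nat).
Implicit Types (p q : {mpoly F[n]}) (A B : {set 'I_n}).

Definition multilinear_in A p :=
  forall m : 'X_{1..n}, m \in msupp p -> forall i, (m i <= (i \in A))%N.

Lemma multilinear_inW A p : multilinear_in A p -> multilinear p.
Proof. by move=> pA m mp i; apply: leq_trans (pA m mp i) (leq_b1 _). Qed.

Lemma multilinear_inS A B p : A \subset B -> multilinear_in A p -> multilinear_in B p.
Proof.
move=> /subsetP sAB pA m mp i; apply: leq_trans (pA m mp i) _.
by have := sAB i; case: (i \in A) => // ->.
Qed.

Lemma multilinear_inD A p q :
  multilinear_in A p -> multilinear_in A q -> multilinear_in A (p + q).
Proof. by move=> pA qA m /msuppD_le; rewrite mem_cat => /orP[/pA|/qA]. Qed.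

Lemma multilinear_inC A c : multilinear_in A c%:MP.
Proof. by move=> m; rewrite msuppC; case: ifP => // _ /[!inE] /eqP -> i; rewrite mnmE. Qed.

Lemma multilinear_inX A i : i \in A -> multilinear_in A 'X_i.
Proof.
by move=> iA m; rewrite msuppX inE => /eqP -> j; rewrite mnm1E; case: eqP => // <-; rewrite iA.
Qed.

Lemma multilinear_inM A B p q : [disjoint A & B] ->
  multilinear_in A p -> multilinear_in B q -> multilinear_in (A :|: B) (p * q).
Proof.
move=> /pred0P dAB pA qB m /msuppM_le /allpairsP[[m1 m2] /= [/pA m1A /qB m2B ->]] i.
have := m1A i; have := m2B i; have := dAB i; rewrite mnmDE !inE /=.
by case: (i \in A); case: (i \in B) => //= _; lia.
Qed.

Lemma syn_multilinear_in (t : aterm F n) :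
  syn_multilinear t -> multilinear_in (avars t) (aeval t).
Proof.
elim: t => [i|c|a IHa b IHb|a IHa b IHb] /=.
- by move=> _; apply: multilinear_inX; rewrite inE.
- by move=> _; apply: multilinear_inC.
- case=> /IHa ha /IHb hb; apply: multilinear_inD.
    exact: multilinear_inS (subsetUl _ _) ha.
  exact: multilinear_inS (subsetUr _ _) hb.
by case=> dab [/IHa ha /IHb hb]; apply: multilinear_inM.
Qed.

Lemma multilinear_interpolation (f : ('I_n -> bool) -> F) :
  (forall v w : 'I_n -> bool, v =1 w -> f v = f w) ->
  exists2 Q : {mpoly F[n]}, multilinear Q & forall v : 'I_n -> bool, Q.@[bool_pt F v] = f v.
Proof.
move=> f_ext.
(* The product of these literals is the indicator of the point [w] on the cube. *)
pose lit (w : {ffun 'I_n -> bool}) (i : 'I_n) : {mpoly F[n]} :=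
  if w i then 'X_i else 1%:MP + (-1)%:MP * 'X_i.
have lit_ml w i : multilinear_in [set i] (lit w i).
  have mX : multilinear_in [set i] ('X_i : {mpoly F[n]}) by apply: multilinear_inX; rewrite inE.
  rewrite /lit; case: ifP => // _; apply: multilinear_inD; first exact: multilinear_inC.
  rewrite -[[set i]]set0U; apply: multilinear_inM mX; last exact: multilinear_inC.
  by rewrite -setI_eq0 set0I.
have prod_ml w s : uniq s -> multilinear_in [set i in s] (\prod_(i <- s) lit w i).
  elim: s => [_|i s IHs /= /andP[iNs /IHs us]]; first by rewrite big_nil; apply: multilinear_inC.
  rewrite big_cons (_ : [set j in i :: s] = [set i] :|: [set j in s]); last first.
    by apply/setP=> j; rewrite !inE.
  apply: multilinear_inM us => //; apply/pred0P=> j /=; rewrite !inE.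
  by apply/negP => /andP[/eqP ->]; apply/negP.
exists (\sum_(w : {ffun 'I_n -> bool}) (f w)%:MP * \prod_i lit w i).
  apply: (@multilinear_inW setT); elim/big_ind: _ => [||w _].
  - by rewrite -mpolyC0; apply: multilinear_inC.
  - exact: multilinear_inD.
  rewrite -[setT]set0U; apply: multilinear_inM; first by rewrite -setI_eq0 set0I.
    exact: multilinear_inC.
  by apply: multilinear_inS (prod_ml w _ (index_enum_uniq _)); apply: subsetT.
move=> v; rewrite raddf_sum /= (bigD1 (finfun v)) //= [X in _ + X]big1 ?addr0 => [|w neq].
  rewrite mevalM mevalC (big_morph _ (mevalM _) (meval1 _)) big1 ?mulr1 => [|i _].
    by apply: f_ext => i; rewrite ffunE.
  rewrite /lit ffunE; case: ifP => vi; rewrite !(mevalD, mevalM, mevalC, mevalXU) /bool_pt vi //.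
  by rewrite mulr0 addr0.
rewrite mevalM (big_morph _ (mevalM _) (meval1 _)) /=.
have [i wi] : exists i, w i != v i.
  apply/existsP; apply: contraNT neq; rewrite negb_exists => /forallP h.
  by apply/eqP/ffunP => i; rewrite ffunE; apply/eqP; have := h i; rewrite negbK.
rewrite (bigD1 i) //= /lit; case: (w i) wi; case vi: (v i) => // _.
  by rewrite mevalXU /bool_pt vi mul0r mulr0.
by rewrite !(mevalD, mevalM, mevalC, mevalXU) /bool_pt vi mulN1r subrr mul0r mulr0.
Qed.

End Multilinear.

(** * Balanced splittings *)

Definition unit_steps (s : nat -> int) := forall i, `|s i.+1 - s i| <= 1.

Lemma discrete_ivt (s : nat -> int) (x y : nat) : unit_steps s ->
  (x <= y)%N -> s x <= 0 -> 0 <= s y -> exists2 z, (x <= z <= y)%N & s z = 0.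
Proof.
move=> s1; elim: y => [|y IHy] lexy sx sy.
  by exists 0%N; [lia | move: lexy sx; rewrite leqn0 => /eqP ->; lia].
have [exy|neq] := eqVneq x y.+1; first by exists y.+1; [lia | rewrite -exy in sy *; lia].
have [s0|sneg] := leP 0 (s y).
  by have [|||z zP sz] := IHy; [lia | | | exists z; [lia|]].
by exists y.+1; [lia | have := s1 y; lia].
Qed.

Lemma unit_stepsN s : unit_steps s -> unit_steps (fun i => - s i).
Proof. by move=> s1 i; have := s1 i; lia. Qed.

Section Window.
Variables (p : nat -> nat) (N : nat).
Hypotheses (p0 : p 0%N = 0%N) (p_step : forall i, (p i <= p i.+1 <= (p i).+1)%N).

(** Below, [p] counts marked points and [s] the excess of one colour in prefixes. Allowing [H] or
    [H.+1] marked points lets the ends of a window move one step at a time. *)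
Let H := (p N)./2.
Let half a b := [&& a <= b <= N, H <= p b - p a & p b - p a <= H.+1]%N.

Lemma p_mono a b : (a <= b)%N -> (p a <= p b)%N.
Proof.
elim: b => [|b IHb]; first by rewrite leqn0 => /eqP ->.
by rewrite leq_eqVlt => /predU1P[-> //|/IHb]; have := p_step b; lia.
Qed.

(** The right end moves when the window holds [H] marked points, the left end when it holds [H.+1].
    The excess [s b - s a] changes by at most 1 per move, so it either vanishes on the way or is
    still positive when the window reaches [N]. *)
Lemma window_walk s a b : unit_steps s -> s N = 0 -> half a b -> s a < s b ->
  (exists c d, half c d /\ s c = s d) \/
  exists2 x, (x <= N)%N & p x = (p N - H)%N /\ s x < 0.
Proof.
move=> s1 sN; have [k] := ubnP (N - a + (N - b))%N; elim: k a b => // k IHk a b lek hab sab.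
have move_to c d : (N - c + (N - d) < N - a + (N - b))%N -> half c d -> s c <= s d ->
    (exists c d, half c d /\ s c = s d) \/
    exists2 x, (x <= N)%N & p x = (p N - H)%N /\ s x < 0.
  move=> lt hcd; rewrite le_eqVlt => /orP[/eqP scd|]; first by left; exists c, d.
  by apply: IHk => //; apply: leq_trans lt _.
have [/andP[leab lebN] leH geH] := and3P hab.
have sa := s1 a; have sb := s1 b; have pa := p_step a; have pb := p_step b.
have mono := p_mono leab; have mN := p_mono lebN.
have [eH|nH] := eqVneq (p b - p a)%N H.
  have [eN|nN] := eqVneq b N.
    right; exists a; first exact: leq_trans lebN.
    by rewrite -eN in sN mN *; split; [lia | rewrite -sN].
  apply: (move_to a b.+1); [lia | rewrite /half; lia | lia].
have neq : a != b.
  by apply/eqP => eab; move: leH nH; rewrite eab subnn leqn0 eq_sym => ->.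
apply: (move_to a.+1 b); [lia | rewrite /half; lia | lia].
Qed.

Lemma half_window s : unit_steps s -> s 0%N = 0 -> s N = 0 ->
  exists a b, [/\ (a <= b <= N)%N, (p b - p a <= (p N)./2.+1)%N,
    (p N - (p b - p a) <= (p N)./2.+1)%N & s a = s b].
Proof.
move=> s1 s0 sN.
suff [a [b [/and3P[leab leH geH] sab]]] : exists c d, half c d /\ s c = s d.
  by exists a, b; split=> //; rewrite /H in leH *; lia.
(* The prefix ending at [x] and the complementary suffix are both half windows, with opposite
   excesses. *)
have [x lexN px] : exists2 x, (x <= N)%N & p x = (p N - H)%N.
  have : (p N - H <= p N)%N by lia.
  elim: {2 3}N => [|M IHM]; first by rewrite p0 leqn0 => /eqP ->; exists 0%N.
  have [/IHM[x lexM px] _|gtM leM] := leqP (p N - H)%N (p M); first by exists x; lia.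
  by exists M.+1 => //; have := p_step M; lia.
have half0 y : (y <= N)%N -> p y = (p N - H)%N -> half 0%N y.
  by move=> leyN py; rewrite /half p0 py /H; lia.
have main (t : nat -> int) : unit_steps t -> t 0%N = 0 -> t N = 0 -> 0 < t x ->
    exists c d, half c d /\ t c = t d.
  move=> t1 t0 tN tx; have [||//|[y leyN [py ty]]] := @window_walk t 0%N x t1 tN.
  - exact: half0.
  - by rewrite t0.
  (* The walk ended at a suffix starting at [y], with [s y] negative and [s x] positive. As [p] is
     constant between [x] and [y], a zero [z] of [s] in between gives the half window from 0 to
     [z]. *)
  have cst z : (x <= z <= y)%N || (y <= z <= x)%N -> p z = (p N - H)%N.
    by case/orP=> /andP[/p_mono + /p_mono]; lia.
  have [lexy|ltyx] := leqP x y.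
    have [||z zP tz] := discrete_ivt (unit_stepsN t1) lexy; [lia | lia |].
    by exists 0%N, z; split; [apply: half0; [lia | apply: cst; rewrite zP] | lia].
  have [||z zP tz] := discrete_ivt t1 (ltnW ltyx); [lia | lia |].
  by exists 0%N, z; split; [apply: half0; [lia | apply: cst; rewrite zP orbT] | lia].
have [sx|sx|sx] := ltrgtP (s x) 0.
- have [|||c [d [hcd scd]]] := main (fun i => - s i) (unit_stepsN s1); try lia.
  by exists c, d; split=> //; lia.
- exact: main.
by exists 0%N, x; split; [exact: half0 | rewrite s0].
Qed.

End Window.

(** * Unions of few segments and their balanced halving *)

Section Segments.
Variable n : nat.
Implicit Types (A P S X : {set 'I_n}).

Definition segment (a b : nat) : {set 'I_n} := [set i : 'I_n | (a <= i < b)%N].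

(** These are the interior ends of the maximal segments of [S]; their number measures how fragmented
    [S] is. *)
Definition cuts S : {set 'I_n} :=
  [set j : 'I_n | [exists i : 'I_n, (j == i.+1 :> nat) && ((i \in S) != (j \in S))]].

Definition balanced X S := #|S :&: X| == #|S :\: X|.

Lemma card_point (a : nat) : (#|[set j : 'I_n | j == a :> nat]| <= 1)%N.
Proof.
by apply/card_le1_eqP => i j; rewrite !inE => /eqP ia /eqP ja; apply: val_inj; rewrite /= ia.
Qed.

Lemma leq_card_cuts A B (a b : nat) :
  A \subset B :|: [set j : 'I_n | j == a :> nat] :|: [set j : 'I_n | j == b :> nat] ->
  (#|A| <= #|B| + 2)%N.
Proof.
move=> /subset_leq_card.
set pa := [set j : 'I_n | j == a :> nat]; set pb := [set j : 'I_n | j == b :> nat].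
have [ha hb] : (#|pa| <= 1 /\ #|pb| <= 1)%N by split; apply: card_point.
move=> le; apply: leq_trans le _; apply: leq_trans (leq_card_setU _ _) _.
rewrite (addnA _ 1 1); apply: leq_add hb; apply: leq_trans (leq_card_setU _ _) _.
by rewrite leq_add2l.
Qed.

(** Away from [a] and [b], a point and its predecessor are both inside or both outside the segment,
    so only these two positions can become new cuts. *)
Lemma card_cuts_inside S a b :
  (#|cuts (S :&: segment a b)| <= #|cuts S :&: segment a b| + 2)%N.
Proof.
apply: (@leq_card_cuts _ _ a b); apply/subsetP => j; rewrite !inE.
case/existsP=> i /andP[/eqP ji]; rewrite !inE.
have [ja|ja] := eqVneq (j : nat) a; first by rewrite orbT.
have [jb|jb] := eqVneq (j : nat) b; rewrite ?orbT // !orbF.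
have -> : (a <= i < b)%N = (a <= j < b)%N by lia.
case: (a <= j < b)%N; rewrite ?andbF // !andbT => neq.
by apply/existsP; exists i; rewrite ji eqxx.
Qed.

Lemma card_cuts_outside S a b :
  (#|cuts (S :\: segment a b)| <= #|cuts S :\: segment a b| + 2)%N.
Proof.
apply: (@leq_card_cuts _ _ a b); apply/subsetP => j; rewrite !inE.
case/existsP=> i /andP[/eqP ji]; rewrite !inE.
have [ja|ja] := eqVneq (j : nat) a; first by rewrite orbT.
have [jb|jb] := eqVneq (j : nat) b; rewrite ?orbT // !orbF.
have -> : (a <= i < b)%N = (a <= j < b)%N by lia.
case: (a <= j < b)%N => //= neq.
by apply/existsP; exists i; rewrite ji eqxx.
Qed.

Lemma card_initial_step A k :
  (#|A :&: segment 0 k| <= #|A :&: segment 0 k.+1| <= #|A :&: segment 0 k|.+1)%N.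
Proof.
apply/andP; split; first by apply/subset_leq_card/setIS/subsetP => i; rewrite !inE; lia.
apply: (@leq_trans (#|A :&: segment 0 k| + #|[set j : 'I_n | j == k :> nat]|)).
  apply: leq_trans (leq_card_setU _ _); apply/subset_leq_card/subsetP => i.
  by rewrite !inE; case: (i \in A) => //=; lia.
by rewrite -addn1 leq_add2l card_point.
Qed.

Lemma card_initial0 A : #|A :&: segment 0 0| = 0%N.
Proof. by apply/eqP; rewrite cards_eq0; apply/eqP/setP => i; rewrite !inE andbF. Qed.

Lemma card_initial_full A : #|A :&: segment 0 n| = #|A|.
Proof. by apply: eq_card => i; rewrite !inE ltn_ord !andbT. Qed.

Lemma card_segment A a b : (a <= b)%N ->
  #|A :&: segment a b| = (#|A :&: segment 0 b| - #|A :&: segment 0 a|)%N.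
Proof.
move=> leab; rewrite -(cardsID (segment 0 a) (A :&: segment 0 b)).
rewrite (_ : A :&: segment 0 b :&: segment 0 a = A :&: segment 0 a); last first.
  by apply/setP => i; rewrite !inE; case: (i \in A) => //=; lia.
rewrite addKn; apply: eq_card => i; rewrite !inE.
by case: (i \in A) => //=; lia.
Qed.

Lemma card_setI_setD A X k :
  #|A :&: segment 0 k| = (#|(A :&: X) :&: segment 0 k| + #|(A :\: X) :&: segment 0 k|)%N.
Proof.
by rewrite -(cardsID X (A :&: segment 0 k)) setIAC setIDAC.
Qed.

(** [half_window] is applied to the prefix counts of [P] and the prefix excesses of one colour in
    [S]: equal excesses at both ends balance the part inside the window, hence also the part
    outside. [P] will be [S] itself or its set of cuts. *)
Lemma balanced_halving X S P : balanced X S ->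
  exists a b, [/\ (a <= b <= n)%N,
    balanced X (S :&: segment a b), balanced X (S :\: segment a b),
    (#|P :&: segment a b| <= #|P|./2.+1)%N & (#|P :\: segment a b| <= #|P|./2.+1)%N].
Proof.
move=> /eqP balS.
pose p k := #|P :&: segment 0 k|.
pose s k : int := #|S :&: X :&: segment 0 k|%:Z - #|(S :\: X) :&: segment 0 k|%:Z.
have [|||||a [b [leab]]] := @half_window p n _ _ s; rewrite /p /s.
- exact: card_initial0.
- by move=> i; apply: card_initial_step.
- move=> i; have := card_initial_step S i; rewrite !(card_setI_setD S X).
  have := card_initial_step (S :&: X) i; have := card_initial_step (S :\: X) i; lia.
- by rewrite !card_initial0.
- by rewrite !card_initial_full balS subrr.
have /andP[leab' _] := leab.
rewrite card_initial_full -(card_segment _ leab') => pin pout eqs.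
have balI : #|S :&: X :&: segment a b| = #|(S :\: X) :&: segment a b|.
  rewrite !(card_segment _ leab').
  have mono A : (#|A :&: segment 0 a| <= #|A :&: segment 0 b|)%N.
    by apply/subset_leq_card/setIS/subsetP => i; rewrite !inE; lia.
  by have := mono (S :&: X); have := mono (S :\: X); move: eqs; lia.
exists a, b; split=> //.
- by rewrite /balanced setIAC -setIDAC balI.
- rewrite /balanced setIDAC setDDl setUC -setDDl.
  have := cardsID (segment a b) (S :&: X); have := cardsID (segment a b) (S :\: X).
  by rewrite balI balS; lia.
by rewrite cardsD.
Qed.

Lemma card_balanced X S : balanced X S -> #|S| = (#|S :&: X|).*2.
Proof. by move=> /eqP bal; rewrite -(cardsID X S) -bal addnn. Qed.

(* A set is recovered from its cuts and its first element by walking upwards. *)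
Lemma cuts_inj S S' : cuts S = cuts S' ->
  (forall i : 'I_n, i = 0%N :> nat -> (i \in S) = (i \in S')) -> S = S'.
Proof.
move=> eqc eq0; apply/setP => -[k ltkn]; elim: k ltkn => [|k IHk] ltkn; first exact: eq0.
have ltk := ltnW ltkn; have := IHk ltk.
have inc (A : {set 'I_n}) :
    (Ordinal ltkn \in cuts A) = ((Ordinal ltk \in A) != (Ordinal ltkn \in A)).
  rewrite inE; apply/existsP/idP => [[i /andP[/eqP /= [ki]]]|neq].
    by rewrite (_ : i = Ordinal ltk) //; apply: val_inj.
  by exists (Ordinal ltk); rewrite eqxx.
have := inc S; rewrite eqc inc => + e; rewrite e.
by do 2![case: (Ordinal _ \in _)]; case: (Ordinal ltkn \in S).
Qed.

(** Each such set consists of the values of a map from [K] indices to [option T], where [None] pads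
    the enumeration. *)
Lemma card_small_sets (T : finType) K :
  (#|[set A : {set T} | (#|A| <= K)%N]| <= #|T|.+1 ^ K)%N.
Proof.
pose F (f : {ffun 'I_K -> option T}) : {set T} := [set a | Some a \in codom f].
apply: (@leq_trans #|[set F f | f : {ffun 'I_K -> option T}]|); last first.
  apply: leq_trans (leq_imset_card _ _) _.
  by rewrite card_ffun card_option card_ord.
apply/subset_leq_card/subsetP => A; rewrite inE => leA.
apply/imsetP; exists [ffun i : 'I_K => nth None [seq Some a | a <- enum A] i] => //.
apply/setP => a; rewrite inE; apply/idP/codomP => [aA|[i]].
  have lti : (index a (enum A) < K)%N.
    by apply: leq_trans leA; rewrite cardE index_mem mem_enum.
  exists (Ordinal lti); rewrite ffunE /= (nth_map a) ?nth_index ?mem_enum //.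
  by rewrite index_mem mem_enum.
rewrite ffunE => e; have := mem_nth None (s := [seq Some a | a <- enum A]) (n := i).
rewrite -e size_map -cardE; case: ltnP => [lti /(_ isT)|lei _].
  by rewrite mem_map ?mem_enum // => ? ? [].
by move: e; rewrite nth_default // size_map -cardE.
Qed.

Definition few_cuts K : {set {set 'I_n}} := [set S | (#|cuts S| <= K)%N].

Lemma card_few_cuts K : (#|few_cuts K| <= 2 * n.+1 ^ K)%N.
Proof.
pose code S := (cuts S, [exists i : 'I_n, (i == 0%N :> nat) && (i \in S)]).
have code_inj : injective code.
  move=> S S' [eqc eq0]; apply: cuts_inj => // i i0.
  have first A : [exists i : 'I_n, (i == 0%N :> nat) && (i \in A)] = (i \in A).
    apply/existsP/idP => [[j /andP[/eqP j0 jA]]|iA]; last by exists i; rewrite i0.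
    by rewrite (_ : i = j) //; apply: val_inj; rewrite /= i0 j0.
  by move: eq0; rewrite !first.
rewrite -(card_imset _ code_inj).
apply: (@leq_trans #|setX [set A : {set 'I_n} | (#|A| <= K)%N] [set: bool]|).
  apply/subset_leq_card/subsetP => _ /imsetP[S SK ->].
  by rewrite !inE andbT; move: SK; rewrite inE.
rewrite cardsX cardsT card_bool mulnC leq_mul2l /=.
by apply: leq_trans (card_small_sets _ _) _; rewrite card_ord.
Qed.

End Segments.

(** * The polynomial *)

Section SplitPolynomial.
Variables (n q : nat).
Implicit Types (S X x y : {set 'I_n}).

(* The index [k < 2 ^ (q + q)] encodes the two ends of a segment in base [2 ^ q]. *)
Definition window k : {set 'I_n} := segment n (k %/ 2 ^ q) (k %% 2 ^ q).

(** The bound 10 suits the alternation: halving a set with at most 8 cuts leaves at most 8+2, and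
    halving the cuts then leaves at most 10/2+1+2 = 8. *)
Definition splittable S k :=
  (S :&: window k \in few_cuts n 10) && (S :\: window k \in few_cuts n 10).

(** The ring is arbitrary because the weights will also be polynomials on a line of weight
    systems. *)
Fixpoint split_val (R : comNzRingType) (w : nat -> {set 'I_n} -> nat -> R) (d : nat) S x : R :=
  if d is d'.+1 then
    \sum_(k < 2 ^ (q + q)) (if splittable S k then
      w d' S k * (split_val w d' (S :&: window k) x * split_val w d' (S :\: window k) x) else 0)
  else match enum S with
       | [::] => 1
       | [:: i; j] => (i \in x)%:R - (j \in x)%:R
       | _ => 0
       end.

Lemma split_val_rmorph (R R' : comNzRingType) (f : {rmorphism R -> R'}) w d S x :
  f (split_val w d S x) = split_val (fun d S k => f (w d S k)) d S x.
Proof.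
elim: d S => [|d IHd] S /=.
  case: (enum S) => [|i [|j [|k s]]]; rewrite ?rmorph1 ?rmorph0 //.
  by rewrite rmorphB !rmorph_nat.
rewrite rmorph_sum; apply: eq_bigr => k _.
by case: ifP; rewrite ?rmorph0 // !rmorphM !IHd.
Qed.

Lemma split_val_ext (R : comNzRingType) (w w' : nat -> {set 'I_n} -> nat -> R) d S x :
  (forall d S k, w d S k = w' d S k) -> split_val w d S x = split_val w' d S x.
Proof.
by move=> ww; elim: d S => [|d IHd] S //=; apply: eq_bigr => k _; rewrite ww !IHd.
Qed.

(** * Weights giving full rank for one colouring *)

Section Monomial.
Variables (F : fieldType).
Implicit Types (f g : {set 'I_n} -> F).

(* The matrix of [f], with rows indexed by subsets of [S :&: X] and columns by subsets of
   [S :\: X], has a nonzero entry in each row and at most one in each column. *)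
Definition monomial X S f :=
  [/\ depends_on S f,
      forall x, exists2 y, y :&: X = x :&: X & f y != 0 &
      forall x y, f x != 0 -> f y != 0 -> (x :&: S) :\: X = (y :&: S) :\: X ->
        x :&: S = y :&: S].

Lemma monomial_ext X S f g : f =1 g -> monomial X S f -> monomial X S g.
Proof.
move=> fg [fS fX finj]; split=> [x|x|x y]; rewrite -?fg //; last exact: finj.
by have [y yx fy] := fX x; exists y; rewrite -?fg.
Qed.

(** For disjoint sets the matrix of the product is a Kronecker product; nonzero points are glued
    along [S1]. *)
Lemma monomialM X S1 S2 f g : [disjoint S1 & S2] ->
  monomial X S1 f -> monomial X S2 g -> monomial X (S1 :|: S2) (fun x => f x * g x).
Proof.
move=> /pred0P dS [fS fX finj] [gS gX ginj]; split.
- by apply: depends_onM; [apply: (depends_onS _ fS); apply: subsetUl |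
    apply: (depends_onS _ gS); apply: subsetUr].
- move=> x; have [y1 yx1 fy] := fX x; have [y2 yx2 gy] := gX x.
  exists ((y1 :&: S1) :|: (y2 :\: S1)).
    apply/setP => i; move/setP: yx1 => /(_ i); move/setP: yx2 => /(_ i).
    rewrite !inE; case: (i \in X); rewrite ?andbF ?andbT // => -> ->.
    by case: (i \in S1); rewrite /= ?andbT ?andbF ?orbF.
  rewrite mulf_neq0 //.
    rewrite -fS (_ : _ :&: S1 = y1 :&: S1) ?fS //; apply/setP => i; rewrite !inE.
    by case: (i \in S1); rewrite /= ?andbT ?andbF ?orbF.
  rewrite -gS (_ : _ :&: S2 = y2 :&: S2) ?gS //; apply/setP => i; rewrite !inE.
  by have := dS i => /=; case: (i \in S1) => /= [->|_]; rewrite ?andbF ?orbF.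
move=> x y; rewrite !mulf_eq0 !negb_or => /andP[fx gx] /andP[fy gy] exy.
have {}exy i : (i \in X) = false -> (i \in S1) || (i \in S2) -> (i \in x) = (i \in y).
  by move=> iX iS; move/setP: exy => /(_ i); rewrite !inE iX iS /= !andbT.
rewrite !setIUr; congr (_ :|: _); [apply: finj => [|//|]|apply: ginj => [|//|]];
  rewrite ?fx ?gx //; apply/setP => i; rewrite !inE; case iX: (i \in X) => //=.
  by case iS: (i \in S1); rewrite ?andbF // !andbT exy // iS.
by case iS: (i \in S2); rewrite ?andbF // !andbT exy // iS orbT.
Qed.

(** A balanced set of at most two elements is empty or a pair of different colours. On Boolean
    points [x_i - x_j] is nonzero exactly when the two bits differ, so its matrix is
    antidiagonal. *)
Lemma monomial_base w X S : balanced X S -> (#|S| <= 2)%N ->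
  monomial X S (@split_val F w 0 S).
Proof.
move=> balS leS; have := card_balanced balS; have := mem_enum S; rewrite cardE /=.
have := enum_uniq S; move: leS; rewrite cardE.
case: (enum S) => [|i [|j [|? ?]]] //= _ uS memS.
- move=> _; have S0 : S = set0 by apply/setP => i; rewrite -memS !inE.
  by split=> // [x|x y]; [exists x; rewrite ?oner_neq0 | rewrite S0 !setI0].
- by case: #|S :&: X|.
move=> cX; have {cX}c1 : #|S :&: X| = 1%N by case: #|S :&: X| cX => [|[|]].
have neq : i != j by move: uS; rewrite inE andbT.
have iS : i \in S by rewrite -memS mem_head.
have jS : j \in S by rewrite -memS !inE eqxx orbT.
have Sij k : (k \in S) = (k == i) || (k == j) by rewrite -memS !inE.
have jX : (j \in X) = (i \notin X).
  have : #|S :\: X| = 1%N by rewrite -(eqP balS).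
  move/eqP/cards1P => [b Sb]; move/eqP/cards1P: c1 => [a Sa].
  move/setP: Sa => Sa; move/setP: Sb => Sb.
  have := Sa i; have := Sa j; have := Sb i; have := Sb j.
  rewrite !inE iS jS /= !andbT; case: (i \in X); case: (j \in X) => //=.
    by move=> _ _ /esym/eqP ja /esym/eqP ia; rewrite ia ja eqxx in neq.
  by move=> /esym/eqP ja /esym/eqP ia; rewrite ia ja eqxx in neq.
have nz (x : {set 'I_n}) : ((i \in x)%:R - (j \in x)%:R != 0 :> F) = ((i \in x) != (j \in x)).
  by case: (i \in x); case: (j \in x); rewrite ?subrr ?eqxx // ?subr0 ?sub0r ?oppr_eq0 oner_eq0.
split.
- by move=> x; rewrite !inE iS jS !andbT.
- move=> x; exists (if i \in X then (if i \in x then x :\ j else j |: x)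
                    else (if j \in x then x :\ i else i |: x)).
    apply/setP => k; rewrite inE [RHS]inE; case kX: (k \in X); rewrite ?andbF // !andbT.
    case iX: (i \in X); case: ifP => _; rewrite !inE; case: eqP => // ek; exfalso; move: kX.
    1,2: by rewrite ek jX iX.
    1,2: by rewrite ek iX.
  have [nij nji] : ((i == j) = false) * ((j == i) = false) by rewrite [j == i]eq_sym (negPf neq).
  by rewrite nz; case: ifP => _; case: ifP => ix; rewrite !inE ?eqxx ?nij ?nji ?ix.
move=> x y; rewrite !nz => nx ny /setP exy; apply/setP => k; rewrite !inE Sij.
have := exy i; have := exy j; rewrite !inE iS jS jX !andbT.
have [->|_] := eqVneq k i; last have [->|_] := eqVneq k j; rewrite ?andbF //= !andbT.
  case: (i \in X) => //= e _; move: nx ny; rewrite e.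
  by do 3![case: (_ \in _)].
case: (i \in X) => //= _ e; move: nx ny; rewrite e.
by do 3![case: (_ \in _)].
Qed.

Definition good_window X P S k :=
  [&& balanced X (S :&: window k), balanced X (S :\: window k),
    (#|P :&: window k| <= #|P|./2.+1)%N & (#|P :\: window k| <= #|P|./2.+1)%N].

(* Halving a set may add two cuts to each half; the next level halves the number of cuts. *)
Definition choice_weight X d S (k : nat) : F :=
  if [pick k' : 'I_(2 ^ (q + q)) | good_window X (if odd d then S else cuts S) S k'] is Some k'
  then (k == k' :> nat)%:R else 0.

(** The weights keep a single good window of the sum; it exists by [balanced_halving], and the
    bounds on the cuts make it splittable. *)
Lemma choice_weight_val X d S : (n < 2 ^ q)%N -> balanced X S ->
  (#|cuts S| <= if odd d then 8 else 10)%N ->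
  exists2 k, good_window X (if odd d then S else cuts S) S k &
  split_val (choice_weight X) d.+1 S =1
    (fun x => split_val (choice_weight X) d (S :&: window k) x *
              split_val (choice_weight X) d (S :\: window k) x).
Proof.
move=> ltn balS cutS; set P := if odd d then S else cuts S.
have [k0 good0] : exists k : 'I_(2 ^ (q + q)), good_window X P S k.
  have [a [b [leab balI balD PI PD]]] := balanced_halving P balS.
  have ltk : (a * 2 ^ q + b < 2 ^ (q + q))%N.
    have : (a.+1 * 2 ^ q <= 2 ^ q * 2 ^ q)%N by rewrite leq_mul2r; apply/orP; right; lia.
    by rewrite expnD mulSn; lia.
  exists (Ordinal ltk); have ltb : (b < 2 ^ q)%N by lia.
  have wE : window (Ordinal ltk) = segment n a b.
    rewrite /window /= divnMDl ?expn_gt0 // divn_small // addn0.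
    by rewrite modnMDl modn_small.
  by apply/and4P; rewrite wE.
have [k wk gk] : exists2 k : 'I_(2 ^ (q + q)),
    forall k', choice_weight X d S k' = (k' == k :> nat)%:R & good_window X P S k.
  have wE k' := erefl (choice_weight X d S k'); move: wE; rewrite {2}/choice_weight -/P.
  by case: pickP => [k gk wE|/(_ k0)]; [exists k | rewrite good0].
exists (val k) => // x; rewrite /= (bigD1 k) //= big1 ?addr0 => [|k' neq]; last first.
  by case: ifP => // _; rewrite wk (_ : (k' == k :> nat) = false) ?mul0r //; apply: negbTE neq.
rewrite wk eqxx mul1r ifT //; case/and4P: gk => _ _ PI PD.
have cI := card_cuts_inside S (k %/ 2 ^ q) (k %% 2 ^ q).
have cD := card_cuts_outside S (k %/ 2 ^ q) (k %% 2 ^ q).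
rewrite /splittable !inE /window; move: cutS PI PD; rewrite /P; case: (odd d) => cutS PI PD.
  have := subset_leq_card (subsetIl (cuts S) (segment n (k %/ 2 ^ q) (k %% 2 ^ q))).
  have := subset_leq_card (subsetDl (cuts S) (segment n (k %/ 2 ^ q) (k %% 2 ^ q))).
  by move: cutS cI cD; clear; lia.
by move: cutS cI cD PI PD; rewrite /window; clear; lia.
Qed.

Lemma choice_weight_step X d S : (n < 2 ^ q)%N -> balanced X S ->
  (#|cuts S| <= if odd d then 8 else 10)%N ->
  (forall A, balanced X A -> (#|A| <= if odd d then #|S|./2.+1 else #|S|)%N ->
    (#|cuts A| <= if odd d then #|cuts S| + 2 else #|cuts S|./2 + 3)%N ->
    monomial X A (split_val (choice_weight X) d A)) ->
  monomial X S (split_val (choice_weight X) d.+1 S).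
Proof.
move=> ltn balS cutS IH; have [k gk E] := choice_weight_val ltn balS cutS.
apply: monomial_ext (fun x => esym (E x)) _.
rewrite -{1}(setID S (window k)); apply: monomialM.
  apply/pred0P => i /=; rewrite !inE.
  by case: (k %/ 2 ^ q <= i < k %% 2 ^ q)%N; rewrite /= ?andbF.
all: case/and4P: gk => balI balD PI PD; apply: IH => //.
- by case: (odd d) PI => // _; apply/subset_leq_card/subsetIl.
- have := card_cuts_inside S (k %/ 2 ^ q) (k %% 2 ^ q).
  have := subset_leq_card (subsetIl (cuts S) (window k)).
  by case: (odd d) PI; rewrite /window; clear; lia.
- by case: (odd d) PD => // _; apply/subset_leq_card/subsetDl.
have := card_cuts_outside S (k %/ 2 ^ q) (k %% 2 ^ q).
have := subset_leq_card (subsetDl (cuts S) (window k)).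
by case: (odd d) PD; rewrite /window; clear; lia.
Qed.

Lemma choice_weight_monomial X h S : (n < 2 ^ q)%N -> balanced X S ->
  (#|S| <= 2 ^ h.+1)%N -> (#|cuts S| <= 8)%N ->
  monomial X S (split_val (choice_weight X) h.*2 S).
Proof.
move=> ltn; elim: h S => [|h IHh] S balS leS cutS; first exact: monomial_base.
rewrite doubleS; apply: choice_weight_step; rewrite ?[odd _]/= ?odd_double //= => A balA leA cutA.
have cutA10 : (#|cuts A| <= 10)%N by apply: leq_trans cutA _; rewrite (leq_add2r 2 _ 8).
apply: choice_weight_step; rewrite ?odd_double //=.
move=> B balB leB cutB; apply: IHh => //; last first.
  by apply: leq_trans cutB _; rewrite (leq_add2r 3 _ 5) (half_leq cutA10).
(* Halving loses 1 in rounding, but [B] is balanced, hence of even size, which removes this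
   excess. *)
have : (#|B| <= (2 ^ h.+1).+1)%N.
  apply: leq_trans leB (leq_trans leA _); rewrite ltnS.
  by apply: leq_trans (half_leq leS) _; rewrite expnS mul2n doubleK.
by rewrite (card_balanced balB) expnS; move: (2 ^ h)%N #|_|; clear; lia.
Qed.

End Monomial.

End SplitPolynomial.

(** * Full rank for all balanced colourings *)

Section CutMatrix.
Variables (T : finType) (m : nat).
Implicit Types (B S X x : {set T}).

Definition subset_nth X (i : nat) : {set T} := nth set0 (enum (powerset X)) i.

(** The fixed size [2 ^ m] gives every [X] a determinant; it is the right size when [X] and
    [S :\: X] have [m] elements each. *)
Definition cut_matrix (R : Type) X S (f : {set T} -> R) : 'M[R]_(2 ^ m) :=
  \matrix_(i, j) f (subset_nth X i :|: subset_nth (S :\: X) j).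

Lemma subset_nth_sub X i : subset_nth X i \subset X.
Proof.
rewrite /subset_nth -powersetE; have [lti|le] := ltnP i (size (enum (powerset X))).
  by rewrite -mem_enum mem_nth.
by rewrite nth_default // powersetE sub0set.
Qed.

Lemma subset_nth_inj X (i j : 'I_(2 ^ m)) : #|X| = m ->
  subset_nth X i = subset_nth X j -> i = j.
Proof.
move=> cX /eqP; rewrite /subset_nth nth_uniq ?enum_uniq -?cardE ?card_powerset ?cX //.
by move/eqP/val_inj.
Qed.

Lemma subset_nth_surj X B : #|X| = m -> B \subset X ->
  exists i : 'I_(2 ^ m), subset_nth X i = B.
Proof.
move=> cX sBX; have lti : (index B (enum (powerset X)) < 2 ^ m)%N.
  by rewrite -cX -card_powerset cardE index_mem mem_enum powersetE.
by exists (Ordinal lti); rewrite /subset_nth nth_index // mem_enum powersetE.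
Qed.

(** A sum of [r] products factors the matrix through dimension [r]. *)
Lemma cut_matrix_rank (F : fieldType) X S (f : {set T} -> F) r :
  \det (cut_matrix X S f) != 0 -> rank_le X r f -> (2 ^ m <= r)%N.
Proof.
rewrite -unitfE -unitmxE => /mxrank_unit rk [s sz fE].
apply: leq_trans sz; rewrite -rk.
have -> : cut_matrix X S f =
    (\matrix_(i < 2 ^ m, k < size s) (nth (fun=> 0, fun=> 0) s k).1 (subset_nth X i)) *m
    (\matrix_(k < size s, j < 2 ^ m) (nth (fun=> 0, fun=> 0) s k).2 (subset_nth (S :\: X) j)).
  apply/matrixP => i j; rewrite !mxE fE (big_nth (fun=> 0, fun=> 0)) big_mkord.
  apply: eq_bigr => k _; rewrite !mxE.
  have sB := subset_nth_sub X i; have := subset_nth_sub (S :\: X) j.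
  rewrite subsetD => /andP[_ dC]; rewrite setIUl (setIidPl sB) setDUl (setDidPl dC).
  move: sB dC; rewrite -setD_eq0 -setI_eq0 => /eqP -> /eqP ->.
  by rewrite setU0 set0U.
exact: leq_trans (mxrankM_maxl _ _) (rank_leq_col _).
Qed.

Lemma cut_matrix_rmorph (R R' : comNzRingType) (h : {rmorphism R -> R'}) X S
    (f : {set T} -> R) (g : {set T} -> R') :
  (forall x, h (f x) = g x) -> h (\det (cut_matrix X S f)) = \det (cut_matrix X S g).
Proof. by move=> hf; rewrite -det_map_mx; congr (\det _); apply/matrixP => i j; rewrite !mxE. Qed.

End CutMatrix.

(** In the column of a nonzero entry of row [i] all other entries vanish, so a vector of the left
    kernel has [i]-th coordinate 0. *)
Lemma monomial_cut_matrix (F : fieldType) n m (X S : {set 'I_n}) (f : {set 'I_n} -> F) :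
  monomial X S f -> X \subset S -> #|X| = m -> #|S :\: X| = m ->
  \det (cut_matrix m X S f) != 0.
Proof.
move=> [fS fX finj] sXS cX cSX; rewrite -unitfE -unitmxE -row_free_unit.
apply/inj_row_free => v v0; apply/rowP => i; rewrite mxE.
have [y yX fy] := fX (subset_nth X i).
have [|j jE] := @subset_nth_surj _ m (S :\: X) (y :&: (S :\: X)) cSX; first exact: subsetIr.
have sub k := subset_nth_sub X k.
have e k : (subset_nth X k :|: (y :&: (S :\: X))) :&: S = subset_nth X k :|: (y :&: (S :\: X)).
  apply/setIidPl; rewrite subUset (subset_trans (sub k) sXS) /=.
  by rewrite (subset_trans (subsetIr _ _)) // subsetDl.
have yE : y :&: S = subset_nth X i :|: (y :&: (S :\: X)).
  rewrite -[subset_nth X i](setIidPl (sub i)) -yX; apply/setP => a; rewrite !inE.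
  have := subsetP sXS a; case: (a \in y); case: (a \in X); case: (a \in S) => //= h.
  by have := h isT.
move/rowP: v0 => /(_ j); rewrite !mxE (bigD1 i) //= !mxE jE big1 ?addr0 => [|k neq].
  by move/eqP; rewrite mulf_eq0 -yE fS (negPf fy) orbF => /eqP.
rewrite mxE jE; case: (eqVneq (f (subset_nth X k :|: y :&: (S :\: X))) 0) => [->|fk].
  by rewrite mulr0.
case/eqP: neq; apply: (subset_nth_inj cX).
have := finj _ _ fk fy; rewrite e yE => eq_xy.
have {eq_xy} /setP eq_xy : subset_nth X k :|: y :&: (S :\: X) = subset_nth X i :|: y :&: (S :\: X).
  apply: eq_xy; apply/setP => a; rewrite !inE; case aX: (a \in X) => //=.
  have nX l : (a \in subset_nth X l) = false by apply/negP => /(subsetP (sub l)); rewrite aX.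
  by rewrite !nX.
apply/setP => a; have := eq_xy a; rewrite !inE.
have [aX|aX] := boolP (a \in X); first by rewrite /= andbF !orbF.
have nX l : (a \in subset_nth X l) = false.
  by apply/negP => /(subsetP (sub l)); rewrite (negPf aX).
by rewrite !nX.
Qed.

(** * Weights good for all colourings at once *)

Section GenericWeights.
Variables (F : fieldType) (n q m d : nat) (S : {set 'I_n}).
Hypothesis charF0 : [pchar F] =i pred0.

Lemma natf_inj : injective (fun k : nat => k%:R : F).
Proof.
have nz := (pcharf0P F).1 charF0.
have aux i j : (i <= j)%N -> i%:R = j%:R :> F -> i = j.
  move=> leij e; apply/eqP; rewrite eqn_leq leij -subn_eq0 -(nz (j - i)%N).
  by rewrite natrB // e subrr eqxx.
by move=> i j e; case/orP: (leq_total i j) => [/aux->|/aux->].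
Qed.

Lemma exists_notin (s : seq F) : exists c, c \notin s.
Proof.
have : ~~ all (mem s) [seq k%:R | k <- iota 0 (size s).+1].
  apply/negP => /allP sub; have := uniq_leq_size _ sub.
  by rewrite size_map size_iota ltnn (map_inj_uniq natf_inj) iota_uniq => /(_ isT).
by case/allPn => c _ cs; exists c.
Qed.

Lemma exists_nonroot (p : {poly F}) : p != 0 -> exists z, p.[z] != 0.
Proof.
move=> nzp; have := max_poly_roots nzp (rs := [seq k%:R | k <- iota 0 (size p)]).
rewrite (map_inj_uniq natf_inj) iota_uniq size_map size_iota ltnn.
case: allP => [_ /(_ isT isT) //|H _].
have : ~~ all (root p) [seq k%:R : F | k <- iota 0 (size p)] by apply/allP.
by case/allPn => z _ pz; exists z.
Qed.

(* Two weight systems, each good for some colourings, are joined by a line; the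
   determinants are polynomials on this line and avoid zero together at some point. *)
Lemma generic_weights (s : seq {set 'I_n}) :
  (forall X, X \in s -> exists w : nat -> {set 'I_n} -> nat -> F,
     \det (cut_matrix m X S (split_val q w d S)) != 0) ->
  exists w : nat -> {set 'I_n} -> nat -> F, forall X, X \in s ->
     \det (cut_matrix m X S (split_val q w d S)) != 0.
Proof.
elim: s => [|X s IHs] good; first by exists (fun _ _ _ => 0).
have [|w ws] := IHs; first by move=> Y Ys; apply: good; rewrite inE Ys orbT.
have [w' w'X] := good X (mem_head _ _).
pose W e A k : {poly F} := (w e A k)%:P + 'X * (w' e A k - w e A k)%:P.
pose P Y := \det (cut_matrix m Y S (split_val q W d S)).
have PE Y z : (P Y).[z] =
    \det (cut_matrix m Y S (split_val q (fun e A k => (W e A k).[z]) d S)).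
  apply: (@cut_matrix_rmorph _ m _ _ (horner_eval z)) => x.
  exact: (split_val_rmorph _ (horner_eval z)).
have P0 Y : (P Y).[0] = \det (cut_matrix m Y S (split_val q w d S)).
  rewrite PE; congr (\det _); apply/matrixP => i j; rewrite !mxE.
  by apply: split_val_ext => e A k; rewrite /W hornerD hornerM hornerX !hornerC; ring.
have P1 Y : (P Y).[1] = \det (cut_matrix m Y S (split_val q w' d S)).
  rewrite PE; congr (\det _); apply/matrixP => i j; rewrite !mxE.
  by apply: split_val_ext => e A k; rewrite /W hornerD hornerM hornerX !hornerC; ring.
have nzP Y : Y \in X :: s -> P Y != 0.
  rewrite inE => /predU1P[->|Ys].
    by apply: contraNneq w'X => PX0; rewrite -P1 PX0 horner0.
  by apply: contraNneq (ws Y Ys) => PY0; rewrite -P0 PY0 horner0.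
have [z nz] : exists z, (\prod_(Y <- X :: s) P Y).[z] != 0.
  by apply: exists_nonroot; rewrite prodf_seq_neq0; apply/allP => Y /nzP.
exists (fun e A k => (W e A k).[z]) => Y Ys; rewrite -PE.
by move: nz; rewrite horner_prod prodf_seq_neq0 => /allP/(_ Y Ys).
Qed.

End GenericWeights.

(** * The circuit *)

Lemma size_flatten_map_leq (A B : Type) (h : A -> seq B) (s : seq A) b :
  (forall x, size (h x) <= b)%N -> (size (flatten [seq h x | x <- s]) <= size s * b)%N.
Proof. by move=> hb; elim: s => //= x s IHs; rewrite size_cat mulSn leq_add. Qed.

Section Circuit.
Variables (F : fieldType) (n q : nat) (w : nat -> {set 'I_n} -> nat -> F).
Implicit Types (S : {set 'I_n}) (f : nat -> aterm F n).

(** The balanced tree makes a sum of [2 ^ e] terms cost only depth [e]. *)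
Fixpoint sum_term (e : nat) f : aterm F n :=
  if e is e'.+1 then AAdd (sum_term e' f) (sum_term e' (fun k => f (2 ^ e' + k)%N)) else f 0%N.

Lemma sum_term_eval e f : aeval (sum_term e f) = \sum_(k < 2 ^ e) aeval (f k).
Proof.
elim: e f => [|e IHe] f; first by rewrite big_ord1.
by rewrite /= !IHe expnS mul2n -addnn big_split_ord.
Qed.

Lemma sum_term_vars e f S : (forall k, avars (f k) \subset S) -> avars (sum_term e f) \subset S.
Proof. by elim: e f => [|e IHe] f fS //=; rewrite subUset !IHe. Qed.

Lemma sum_term_syn e f : (forall k, syn_multilinear (f k)) -> syn_multilinear (sum_term e f).
Proof. by elim: e f => [|e IHe] f fS //=; split; apply: IHe. Qed.

Lemma sum_term_depth e f b : (forall k, adepth (f k) <= b)%N -> (adepth (sum_term e f) <= e + b)%N.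
Proof. by elim: e f => [|e IHe] f fb //=; rewrite addSn ltnS geq_max !IHe. Qed.

Lemma sum_term_subterms e f : exists2 l : seq (aterm F n), (size l < 2 ^ e)%N &
  forall t, t \in asubterms (sum_term e f) ->
    t \in l \/ exists2 k, (k < 2 ^ e)%N & t \in asubterms (f k).
Proof.
elim: e f => [|e IHe] f; first by exists [::] => // t tf; right; exists 0%N.
have [l lsz lP] := IHe f; have [l' lsz' lP'] := IHe (fun k => f (2 ^ e + k)%N).
exists (sum_term e.+1 f :: l ++ l'); first by rewrite /= size_cat expnS; lia.
move=> t; rewrite /= inE mem_cat => /orP[/eqP ->|/orP[/lP|/lP']].
- by left; rewrite mem_head.
- case=> [tl|[k ltk tk]]; first by left; rewrite inE mem_cat tl orbT.
  by right; exists k => //; rewrite expnS; lia.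
case=> [tl|[k ltk tk]]; first by left; rewrite inE mem_cat tl !orbT.
by right; exists (2 ^ e + k)%N => //; rewrite expnS; lia.
Qed.

Fixpoint split_term (d : nat) S : aterm F n :=
  if d is d'.+1 then
    sum_term (q + q) (fun k => if splittable q S k then
      AMul (AConst (w d' S k))
        (AMul (split_term d' (S :&: window n q k)) (split_term d' (S :\: window n q k)))
      else AConst 0)
  else match enum S with
       | [::] => AConst 1
       | [:: i; j] => AAdd (AVar i) (AMul (AConst (-1)) (AVar j))
       | _ => AConst 0
       end.

Lemma split_term_eval d S (x : {set 'I_n}) :
  (aeval (split_term d S)).@[bool_pt F (fun i => i \in x)] = split_val q w d S x.
Proof.
elim: d S => [|d IHd] S /=.
  case: (enum S) => [|i [|j [|k s]]] /=; rewrite ?mevalC //.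
  by rewrite mevalD mevalM mevalC !mevalXU mulN1r.
rewrite sum_term_eval raddf_sum; apply: eq_bigr => k _ /=.
by case: ifP => _ /=; rewrite ?mevalM !mevalC ?IHd.
Qed.

Lemma split_term_vars d S : avars (split_term d S) \subset S.
Proof.
elim: d S => [|d IHd] S /=.
  have := mem_enum S; case: (enum S) => [|i [|j [|k s]]] memS //=; rewrite ?sub0set //.
  by rewrite set0U subUset !sub1set -!memS !inE !eqxx orbT.
apply: sum_term_vars => k; case: ifP => _ /=; rewrite ?sub0set // set0U subUset.
by rewrite (subset_trans (IHd _) (subsetIl _ _)) (subset_trans (IHd _) (subsetDl _ _)).
Qed.

Lemma split_term_syn d S : syn_multilinear (split_term d S).
Proof.
have dis0 (A : {set 'I_n}) : [disjoint set0 & A] by rewrite -setI_eq0 set0I.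
elim: d S => [|d IHd] S /=; first by case: (enum S) => [|i [|j [|k s]]] //=.
apply: sum_term_syn => k; case: ifP => _ //=; split=> //; split=> //; split=> //.
apply: disjointWl (split_term_vars _ _) (disjointWr (split_term_vars _ _) _).
by rewrite -setI_eq0; apply/eqP/setP => i; rewrite !inE; case: (_ <= i < _)%N; rewrite /= ?andbF.
Qed.

Lemma split_term_depth d S : (adepth (split_term d S) <= d * (q + q + 2) + 2)%N.
Proof.
elim: d S => [|d IHd] S /=; first by case: (enum S) => [|i [|j [|k s]]].
apply: leq_trans (sum_term_depth (b := d * (q + q + 2) + 4) _ _) _; last by rewrite mulSn; lia.
move=> k; case: ifP => _ //=; rewrite max0n.
have := IHd (S :&: window n q k); have := IHd (S :\: window n q k); lia.
Qed.

(** By sharing, each level needs one block of gates per set with few cuts, and there are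
    polynomially many such sets. A block has fewer than [2 ^ (q + q)] additions and three gates per
    window; the extra 1 covers the five gates of a binomial. *)
Lemma split_term_subterms d : exists2 l : seq (aterm F n),
  (size l <= d.+1 * (#|few_cuts n 10| * (4 * 2 ^ (q + q) + 1)))%N &
  forall S, S \in few_cuts n 10 -> {subset asubterms (split_term d S) <= l}.
Proof.
elim: d => [|d [l lsz lP]].
  exists (flatten [seq asubterms (split_term 0 A) | A <- enum (few_cuts n 10)]).
    rewrite mul1n cardE; apply: size_flatten_map_leq => S.
    have : (0 < 2 ^ (q + q))%N by rewrite expn_gt0.
    by rewrite /=; case: (enum S) => [|i [|j [|k s]]] /=; lia.
  by move=> S SF t tS; apply/flatten_mapP; exists S; rewrite ?mem_enum.
pose g S k := AMul (split_term d (S :&: window n q k)) (split_term d (S :\: window n q k)).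
pose f S k := if splittable q S k then AMul (AConst (w d S k)) (g S k) else AConst 0.
have /fin_all_exists2[h hsz hP] (S : {set 'I_n}) := sum_term_subterms (q + q) (f S).
pose local S := h S ++
  flatten [seq [:: f S k; AConst (w d S k); g S k] | k <- iota 0 (2 ^ (q + q))].
exists (l ++ flatten [seq local A | A <- enum (few_cuts n 10)]).
  rewrite size_cat [X in (_ <= X)%N]mulSn addnC leq_add // cardE; apply: size_flatten_map_leq => S.
  rewrite size_cat; have := hsz S.
  have := @size_flatten_map_leq _ _ (fun k => [:: f S k; AConst (w d S k); g S k])
    (iota 0 (2 ^ (q + q))) 3 (fun=> leqnn 3).
  by rewrite size_iota; lia.
move=> S SF t /hP tS; rewrite mem_cat.
have inl t' : t' \in local S ->
    (t' \in l) || (t' \in flatten [seq local A | A <- enum (few_cuts n 10)]).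
  by move=> t'l; apply/orP; right; apply/flatten_mapP; exists S; rewrite ?mem_enum.
case: tS => [th|[k ltk]]; first by apply: inl; rewrite mem_cat th.
have ink t' : t' \in [:: f S k; AConst (w d S k); g S k] -> t' \in local S.
  move=> t'k; rewrite mem_cat; apply/orP; right; apply/flatten_mapP; exists k => //.
  by rewrite mem_iota.
rewrite {1}/f; case: ifP => [sp|nsp] /=; last first.
  by rewrite inE => /eqP ->; apply/inl/ink; rewrite /f nsp mem_head.
rewrite !inE mem_cat => /orP[/eqP ->|/orP[/eqP ->|/orP[/eqP ->|tg]]].
- by apply/inl/ink; rewrite /f sp mem_head.
- by apply/inl/ink; rewrite !inE eqxx orbT.
- by apply/inl/ink; rewrite !inE eqxx !orbT.
by case/andP: sp => sI sD; case/orP: tg => [/(lP _ sI)->|/(lP _ sD)->].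
Qed.

Lemma split_term_csize d S : S \in few_cuts n 10 ->
  (csize (split_term d S) <= d.+1 * (2 * n.+1 ^ 10 * (4 * 2 ^ (q + q) + 1)))%N.
Proof.
move=> SF; have [l lsz lP] := split_term_subterms d.
apply: leq_trans (uniq_leq_size (undup_uniq _) (s2 := l) _) (leq_trans lsz _).
  by move=> t; rewrite mem_undup; apply: lP.
by rewrite leq_mul2l /= leq_mul2r card_few_cuts orbT.
Qed.

End Circuit.

(** * The separation *)

Lemma meval_linear_last (F : fieldType) n (C : {mpoly F[n.+1]}) (v : 'I_n -> F) r :
  (forall m : 'X_{1..n.+1}, m \in msupp C -> m ord_max = 1%N) ->
  C.@[fun i => if unlift ord_max i is Some j then v j else r] =
  r * C.@[fun i => if unlift ord_max i is Some j then v j else 1].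
Proof.
move=> C1; rewrite !mevalE big_distrr /=; apply: eq_big_seq => m mC.
rewrite (bigD1 ord_max) //= [in RHS](bigD1 ord_max) //= unlift_none (C1 m mC) !expr1 mul1r.
rewrite mulrCA; congr (_ * (_ * _)); apply: eq_bigr => i neq.
by case: unliftP neq => [j ->|->] //; rewrite eqxx.
Qed.

(** The Boolean axioms vanish on the cube, so C(x, Q(x)) = 1 there, and linearity in the placeholder
    rewrites this as Q(x) C(x, 1) = 1. *)
Lemma refutation_cube_val (F : fieldType) n (Q : {mpoly F[n]}) (C : {mpoly F[n.+1]})
    (v : 'I_n -> bool) : IPS_LIN'_refutation Q C ->
  Q.@[bool_pt F v] * C.@[fun i => if unlift ord_max i is Some j then (v j)%:R else 1] = 1.
Proof.
case=> C1 [h hE]; have := congr1 (fun p => p.@[bool_pt F v]) hE.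
rewrite mevalB meval1 comp_mpoly_meval raddf_sum /= big1 => [|i _]; last first.
  rewrite mevalM mevalB rmorphXn /= mevalXU /bool_pt.
  by case: (v i); rewrite ?expr1n ?expr0n subrr mulr0.
move=> /eqP; rewrite subr_eq0 => /eqP C_eq1.
apply: etrans (esym (meval_linear_last (bool_pt F v) _ C1)) (etrans _ C_eq1).
by apply: meval_eq => i; rewrite tnth_mktuple; case: unlift => [j|] //; rewrite mevalXU.
Qed.

(** The squared ranks are summed over all colourings. Balanced colourings of [S] alone contribute
    4^m each, and they number at least 4^m/(2m+1); the block decomposition bounds the total by 4^n
    size^2 / D^k. The factor 4 pays for n <= 2m+1. *)
Lemma formula_lower_bound (F : fieldType) n N (e : 'I_N -> option 'I_n) (t : aterm F N)
    (f : {set 'I_n} -> F) m (S : {set 'I_n}) D k :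
  (forall i j a, e i = Some a -> e j = Some a -> i = j) ->
  syn_multilinear t -> (forall x, cube_val e t x = f x) ->
  #|S| = m.*2 -> (n <= m.*2.+1)%N -> (0 < D)%N -> (9 * D ^ 2 * 3 ^ k <= n)%N ->
  (forall X : {set 'I_n}, X \subset S -> #|X| = m -> \det (cut_matrix m X S f) != 0) ->
  (D ^ k <= 4 * m.*2.+1 * fsize t ^ 2)%N.
Proof.
move=> e_inj syn_t tf cS len D0 leM full.
have /block_sum_rank_bound[r rX rsum] : block_sum (9 * D ^ 2) k setT (fsize t) f.
  apply: (block_sum_ext (f := fun x => cube_val e t x * 1)); first by move=> x; rewrite mulr1.
  apply: (formula_block_sum (U := set0) (h := fun=> 1) e_inj) => //;
    rewrite ?subsetT ?sub0set ?cards0 ?cardsT ?card_ord //.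
    by rewrite !muln_gt0 D0.
  by rewrite -setI_eq0 set0I.
have low : ('C(m.*2, m) * 4 ^ m <= \sum_(X in powerset [set: 'I_n]) r X ^ 2)%N.
  rewrite -cS -cards_draws -sum_nat_const.
  rewrite powersetT [leqRHS](big_setID [set A : {set 'I_n} | A \subset S & #|A| == m]) setTI /=.
  apply: leq_trans (leq_addr _ _).
  apply: leq_sum => X; rewrite inE => /andP[sXS /eqP cX].
  rewrite (_ : 4 ^ m = (2 ^ m) ^ 2)%N; last by rewrite -expnM mulnC expnM.
  by rewrite leq_sqr; apply: cut_matrix_rank (full X sXS cX) (rX X (subsetT _)).
have central := leq_expn2_central m.*2; rewrite doubleK -mul2n expnM in central.
have up : (D ^ k * ('C(m.*2, m) * 4 ^ m) <= fsize t ^ 2 * (4 * (4 ^ m * 4 ^ m)))%N.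
  apply: leq_trans (leq_trans rsum _); first by rewrite leq_mul2l low orbT.
  rewrite leq_mul2l cardsT card_ord -expnD addnn -expnS leq_exp2l //.
  by rewrite len orbT.
rewrite -(@leq_pmul2r (4 ^ m * 4 ^ m)) ?muln_gt0 ?expn_gt0 //.
apply: (@leq_trans (D ^ k * (m.*2.+1 * 'C(m.*2, m) * 4 ^ m))).
  by rewrite leq_mul2l leq_mul2r -mul2n central !orbT.
have := leq_mul (leqnn m.*2.+1) up.
move: (D ^ k)%N ('C(_, _)) (4 ^ m)%N (fsize t ^ 2)%N m.*2.+1 => a b p s u le_up.
have -> : (a * (u * b * p) = u * (a * (b * p)))%N by ring.
by apply: leq_trans le_up _; rewrite leq_eqVlt; apply/orP; left; apply/eqP; ring.
Qed.

(** For [r >= 18] the factor 2^(L+7) is at most the square root of 2^(r^2), so 2^(r^2) <= f^4. Since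
    L+1 <= 16r, a power 16^2 = 256 of this covers N^L. *)
Lemma quasipoly_bound N L f : (N < 2 ^ L.+1)%N -> (144 <= L)%N -> (0 < f)%N ->
  ((2 ^ (L %/ 8)) ^ (L %/ 8) <= 2 ^ (L + 3) * (f + 2) ^ 2)%N ->
  (N ^ L <= f ^ (4 * 256))%N.
Proof.
move=> ltN leL f0; set r := (L %/ 8)%N => le_rr.
have r18 : (18 <= r)%N by rewrite /r; lia.
have Lr : (L <= 8 * r + 7)%N by rewrite /r; lia.
have rr : (18 * r <= r * r)%N by rewrite leq_mul2r r18 orbT.
have lef : ((f + 2) ^ 2 <= 2 ^ 4 * f ^ 2)%N by rewrite -(expnMn 4 f 2) leq_sqr; lia.
have le1 : (2 ^ (r * r) <= 2 ^ (L + 7) * f ^ 2)%N.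
  rewrite expnM; apply: leq_trans le_rr _.
  rewrite (_ : L + 7 = L + 3 + 4)%N; last by lia.
  by rewrite (expnD 2 (L + 3)) -mulnA leq_mul2l lef orbT.
have le2 : (2 ^ (r * r) <= f ^ 4)%N.
  rewrite -(@leq_pmul2l (2 ^ (r * r))) ?expn_gt0 // mulnn.
  apply: (@leq_trans ((2 ^ (L + 7) * f ^ 2) ^ 2)); first by rewrite leq_sqr.
  by rewrite expnMn -!expnM leq_mul2r leq_exp2l //; apply/orP; right; lia.
have : (N ^ L <= (2 ^ (r * r)) ^ 256)%N.
  apply: (@leq_trans ((2 ^ L.+1) ^ L)).
    by rewrite leq_exp2r ?(ltnW ltN) //; lia.
  rewrite -!expnM leq_exp2l //; have := leq_mul (_ : L.+1 <= 16 * r)%N (_ : L <= 16 * r)%N.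
  by move=> /(_ ltac:(lia) ltac:(lia)); lia.
have pow c : (0 < c)%N -> ((2 ^ (r * r)) ^ c <= f ^ (4 * c))%N.
  by move=> c0; rewrite (expnM f) leq_exp2r.
by move/leq_trans; apply; apply: pow.
Qed.

Lemma card_prefix n k : (k <= n)%N -> #|segment n 0 k| = k.
Proof.
move=> lekn; have inj : injective (widen_ord lekn) by move=> i j /(congr1 val) /= /val_inj.
rewrite -[RHS]card_ord -(card_imset _ inj).
apply: eq_card => i; rewrite inE leq0n; apply/idP/imsetP => [ltik|[j _ ->]];
  last exact: (ltn_ord j).
by exists (Ordinal ltik) => //; apply: val_inj.
Qed.

Lemma card_cuts_prefix n k : (#|cuts (segment n 0 k)| <= 2)%N.
Proof.
rewrite -[segment n 0 k]setTI; apply: leq_trans (card_cuts_inside _ _ _) _.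
rewrite (_ : cuts [set: 'I_n] = set0) ?set0I ?cards0 //.
by apply/setP => j; rewrite !inE; apply/existsP => -[i]; rewrite !inE andbF.
Qed.

(** For odd [n] the last variable is dropped so that [S] has balanced colourings; as a prefix, [S]
    has at most two cuts. *)
Lemma generic_split_weights (F : fieldType) n L : [pchar F] =i pred0 -> (n < 2 ^ L.+1)%N ->
  let S := segment n 0 (n./2).*2 in
  exists w : nat -> {set 'I_n} -> nat -> F, forall X : {set 'I_n}, X \subset S -> #|X| = n./2 ->
    \det (cut_matrix n./2 X S (split_val L.+1 w L.*2 S)) != 0.
Proof.
move=> charF0 ltn S; have leS : ((n./2).*2 <= n)%N by lia.
have cS : #|S| = (n./2).*2 by apply: card_prefix.
pose s := enum [set X : {set 'I_n} | X \subset S & #|X| == n./2].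
have [X|w wP] := @generic_weights F n L.+1 n./2 L.*2 S charF0 s; last first.
  by exists w => X sXS cX; apply: wP; rewrite mem_enum inE sXS cX eqxx.
rewrite mem_enum inE => /andP[sXS /eqP cX].
have cSX : #|S :\: X| = n./2 by rewrite cardsD (setIidPr sXS) cS cX; lia.
exists (choice_weight L.+1 F X); apply: monomial_cut_matrix => //.
apply: choice_weight_monomial => //.
- by rewrite /balanced (setIidPr sXS) cX cSX.
- by rewrite cS; lia.
by apply: leq_trans (card_cuts_prefix _ _) _.
Qed.

Lemma poly_size_bound N L : (2 ^ L <= N)%N -> (1 <= L)%N ->
  (L.*2.+1 * (2 * N.+1 ^ 10 * (4 * 2 ^ (L.+1 + L.+1) + 1)) + 2 <= 40 * N ^ 40)%N.
Proof.
move=> leN L1; have ltLN : (L < N)%N by apply: leq_trans leN; apply: ltn_expl.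
have N2 : (2 <= N)%N by lia.
have e4 : (2 ^ (L.+1 + L.+1) <= 4 * N ^ 2)%N.
  rewrite expnD mulnn (expnS 2 L) expnMn leq_mul2l /=.
  by rewrite leq_sqr.
have a1 : (L.*2.+1 <= N ^ 2)%N by rewrite -mulnn; nia.
have a2 : (N.+1 ^ 10 <= N ^ 20)%N.
  by rewrite (expnM N 2 10) leq_exp2r // -mulnn; nia.
have a3 : (4 * 2 ^ (L.+1 + L.+1) + 1 <= N ^ 7)%N.
  apply: (@leq_trans (2 ^ 5 * N ^ 2)); first by have := leq_exp2r 0 N (isT : (0 < 2)%N); lia.
  by rewrite (expnD N 5 2) leq_mul2r leq_exp2r // N2 orbT.
apply: (@leq_trans (N ^ 2 * (N * N ^ 20 * N ^ 7) + N ^ 30)).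
  apply: leq_add; first exact: leq_mul a1 (leq_mul (leq_mul N2 a2) a3).
  by have N1 := ltnW N2; apply: leq_trans N2 _; rewrite -[X in (X <= _)%N]expn1 leq_pexp2l.
rewrite -expnS -!expnD (_ : 2 + (21 + 7) = 30)%N //.
have le : (N ^ 30 <= N ^ 40)%N by rewrite leq_pexp2l // ltnW.
apply: leq_trans (leq_add le le) _.
by rewrite addnn -mul2n leq_mul2r orbT.
Qed.

Lemma csize_addC (F : fieldType) n (t : aterm F n) c :
  (csize (AAdd t (AConst c)) <= csize t + 2)%N.
Proof.
rewrite /csize; set s := asubterms t.
apply: (@leq_trans (size (AAdd t (AConst c) :: AConst c :: undup s))); last by rewrite /= addn2.
apply: uniq_leq_size (undup_uniq _) _ => u; rewrite mem_undup /= !inE mem_cat mem_undup inE.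
by case/orP => [->//|/orP[->|->]]; rewrite ?orbT.
Qed.

(* log N := trunc_log 2 N.  poly(N) := c * N^c, O(log^2 N) := c * (log N)^2,
   N^{Omega(log N)} := N^{(log N)/k}, i.e. N^(log N) <= size^k. *)
Theorem theorem1p7 (F : fieldType) (charF0 : [pchar F] =i pred0) :
  exists (c k N0 : nat), (0 < k)%N /\
  forall N : nat, (N0 <= N)%N ->
  exists Q : {mpoly F[N]},
    multilinear Q /\ unsat_cube Q /\
    (exists (G : {mpoly F[N]}) (t : aterm F N),
        ml_functional_refutation Q G /\ aeval t = G /\
        syn_multilinear t /\
        (csize t <= c * N ^ c)%N /\
        (adepth t <= c * (trunc_log 2 N) ^ 2)%N) /\
    (forall phi : aterm F N.+1, mlNC1_IPS_LIN'_refutation Q phi ->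
        (N ^ trunc_log 2 N <= (fsize phi) ^ k)%N).
Proof.
have [N0 N0P] : exists N0, forall N, (N0 <= N)%N -> (0 < N)%N /\ (144 <= trunc_log 2 N)%N.
  exists (2 ^ 144)%N => N leN; have N_gt0 : (0 < N)%N by apply: leq_trans leN; rewrite expn_gt0.
  by split=> //; rewrite trunc_log_max.
exists 40%N, (4 * 256)%N, N0; split=> // N /N0P[N_gt0].
move: (trunc_log_bounds (isT : 1 < 2)%N N_gt0).
set L := trunc_log 2 N => /andP[leN ltN] leL.
pose m := N./2; pose S := segment N 0 m.*2.
have [w wP] := generic_split_weights charF0 ltN.
pose p x := split_val L.+1 w L.*2 S x.
(* The values of [p] on the cube are finitely many and [F] is infinite, so some shift [c] makes
   [p + c] nonvanishing there. *)
have [c cP] := exists_notin charF0 [seq - p x | x : {set 'I_N}].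
pose t := AAdd (split_term L.+1 w L.*2 S) (AConst c).
have tE (v : 'I_N -> bool) : (aeval t).@[bool_pt F v] = p [set i | v i] + c.
  rewrite /= mevalD mevalC /p -split_term_eval; congr (_ + _).
  by apply: meval_eq => i; rewrite /bool_pt inE.
have t_neq0 v : (aeval t).@[bool_pt F v] != 0.
  rewrite tE; apply: contraNneq cP => e; apply/mapP; exists [set i | v i].
    by rewrite mem_enum.
  by apply/eqP; rewrite -addr_eq0 addrC e.
have syn_t : syn_multilinear t by split=> //; apply: split_term_syn.
(* [Q] interpolates the inverses of the values of [t], so it has no zero on the cube and [t] refutes
   it. *)
have [|Q Qml QE] := @multilinear_interpolation F N (fun v => ((aeval t).@[bool_pt F v])^-1).
  by move=> v v' vv'; congr (_^-1); apply: meval_eq => i; rewrite /bool_pt vv'.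
exists Q; split=> //; split; first by move=> v; rewrite QE invr_eq0.
split.
  exists (aeval t), t; split; last split=> //.
    split=> [|v]; last by rewrite QE mulfV.
    exact: multilinear_inW (syn_multilinear_in syn_t).
  split=> //; split.
    apply: leq_trans (csize_addC _ _) (leq_trans _ (poly_size_bound leN _)); last by lia.
    rewrite leq_add2r; apply: split_term_csize; rewrite inE.
    exact: leq_trans (card_cuts_prefix _ _) _.
  rewrite /= maxn0; have := split_term_depth L.+1 w L.*2 S.
  rewrite -mulnn => /leq_ltn_trans; apply; nia.
move=> phi [/sem_to_syn_multilinear[phi' [phiE syn_phi lephi _]] ref].
pose e := unlift (@ord_max N).
have e_inj i j a : e i = Some a -> e j = Some a -> i = j.
  by rewrite /e; case: unliftP => // k -> [->]; case: unliftP => // l -> [->].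
(* With the placeholder set to 1, [phi'] takes the values [p + c]; removing [c] costs two gates,
   whence the [f + 2] in [quasipoly_bound]. *)
pose phi_c := AAdd phi' (AConst (- c)).
have phi_val x : cube_val e phi_c x = p x.
  rewrite cube_valD {2}/cube_val /= mevalC; apply/eqP; rewrite subr_eq; apply/eqP.
  have := refutation_cube_val (fun i => i \in x) ref; rewrite QE -phiE.
  move/(canRL (mulKf (invr_neq0 (t_neq0 _)))); rewrite invrK mulr1 tE.
  by rewrite (_ : [set i | i \in x] = x) //; apply/setP => i; rewrite inE.
have cS : #|S| = m.*2 by apply: card_prefix; rewrite /m; lia.
apply: leq_trans (_ : _ <= fsize phi' ^ (4 * 256))%N _; last by rewrite leq_exp2r.
apply: quasipoly_bound => //; first by case: (phi').
(* With D = 2^r and k = r, the number of variables required is at most 2^(4+4r) <= 2^L <= N. *)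
set r := (L %/ 8)%N; have r18 : (18 <= r)%N by rewrite /r; lia.
apply: leq_trans (formula_lower_bound (k := r) e_inj _ phi_val cS _ _ _ wP) _.
- by split.
- by rewrite /m; lia.
- by rewrite expn_gt0.
- have le34 : (3 ^ r <= 4 ^ r)%N by rewrite leq_exp2r //; lia.
  apply: leq_trans leN; rewrite -expnM.
  apply: leq_trans (leq_mul (leq_mul (isT : 9 <= 2 ^ 4)%N (leqnn _)) le34) _.
  have e4 : (4 ^ r = 2 ^ (2 * r))%N by rewrite expnM.
  by rewrite e4 -!expnD leq_exp2l // /r; lia.
rewrite /= addn1 addn2 leq_mul2r; apply/orP; right.
rewrite addn3 !(expnS 2 _.+1) mulnA leq_mul2l /=.
by apply: leq_trans ltN; rewrite /m ltnS; lia.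
Qed.
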